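(* Let $\Sigma$ be a compact Riemann surface with conformal metric $h$ of curvature $-1$, $U$ a holomorphic cubic differential on $\Sigma$ and $u$ a small solution to $\Delta u-16\|U\|_h^2e^{-2u}-2e^u+2=0$, with associated representation $\rho:\pi_1\Sigma\to SU(2,1)$. Suppose $\|U\|_h<\kappa$ on $\Sigma$, where $\kappa>0$ is a constant such that this bound always guarantees that the normal exponential map $\Phi:\tilde\Sigma\times\mathcal D\to\mathbb{CH}^2$ is a diffeomorphism and that its extension $\bar\Phi:\tilde\Sigma\times\bar{\mathcal D}\to\overline{\mathbb{CH}^2}$ is injective. Then there is a fundamental domain $\mathcal F$ in $\mathbb{CH}^2$ for the action of $\pi_1\Sigma$ on $\mathbb{CH}^2$ via $\rho$ with the following property: if $\bar{\mathcal F}$ denotes the closure of $\mathcal F$ in $\overline{\mathbb{CH}^2}\subset\mathbb{CP}^2$, then there are only a finite number of $\gamma\in\pi_1\Sigma$ satisfying $\gamma\cdot\bar{\mathcal F}\cap\bar{\mathcal F}\ne\emptyset$.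
   Context: If locally $h=\gamma|dz|^2$ and $U=Q\,dz^3$, then $\|U\|_h^2=|Q|^2/\gamma^3$, and $\Delta=\frac4\gamma\partial_z\partial_{\bar z}$. A function $u$ on $\Sigma$ is small if $u\ge\frac13\log(16\max_\Sigma\|U\|_h^2)$ (no constraint when $U=0$). On $\mathbb C^3$ let $\langle u,v\rangle=u_1\bar v_1+u_2\bar v_2-u_3\bar v_3$, $W_-=\{u:\langle u,u\rangle<0\}$, $\mathbb{CH}^2=\mathbb PW_-\subset\mathbb{CP}^2$ with closure $\overline{\mathbb{CH}^2}$ in $\mathbb{CP}^2$, $\pi$ the projection $\mathbb C^3\setminus\{0\}\to\mathbb{CP}^2$. Frame and representation: identify the universal cover $\tilde\Sigma$ with the Poincaré disc with coordinate $z$; write $e^uh=2s^2|dz|^2$ ($s>0$), $U=Q\,dz^3$ and $\alpha=A\,dz+B\,d\bar z$ with $$A=\begin{pmatrix}s^{-1}s_z & 0 & s \\ -Qs^{-2} & -s^{-1}s_z & 0 \\ 0 & s & 0\end{pmatrix},\quad B=\begin{pmatrix}-s^{-1}s_{\bar z} & \bar Qs^{-2} & 0 \\ 0 & s^{-1}s_{\bar z} & s \\ s & 0 & 0\end{pmatrix}.$$ There is $F=(f_1\ f_2\ f_3):\tilde\Sigma\to SU(2,1)$, unique up to left multiplication by a constant, with $F^{-1}dF=\alpha$, and a representation $\rho$ with $F(\gamma z)=\rho(\gamma)F(z)c_\gamma(z)^{-1}$, $c_\gamma=\mathrm{diag}(\gamma'/|\gamma'|,\overline{\gamma'}/|\gamma'|,1)$,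 for deck transformations $\gamma\in\pi_1\Sigma$. The group acts on $\overline{\mathbb{CH}^2}$ via $\rho$. $\mathcal D=\{(a,b)\in\mathbb R^2:a^2+b^2<\frac12\}$, $\Phi(z,a,b)=\pi[(ia-b)f_1(z)+(ia+b)f_2(z)+f_3(z)]$, and $\bar\Phi$ is given by the same formula on $\tilde\Sigma\times\bar{\mathcal D}$. A constant $\kappa$ as in the claim exists. ''Fundamental domain'' has the usual meaning: the translates of its closure in $\mathbb{CH}^2$ cover $\mathbb{CH}^2$, and translates of its interior by distinct group elements are disjoint. *)

(* Defs.v *)
From HB Require Import structures.
From mathcomp Require Import all_boot all_order all_algebra.
From mathcomp Require Import complex.
From mathcomp Require Import all_classical all_reals all_analysis.

Set Implicit Arguments.
Unset Strict Implicit.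
Unset Printing Implicit Defensive.

Import Order.TTheory GRing.Theory Num.Theory.
Import numFieldNormedType.Exports.

Local Open Scope classical_set_scope.
Local Open Scope ring_scope.
Local Open Scope complex_scope.
Local Open Scope quotient_scope.

(* The norm topology of R[i] lives on its alias R[i]^o. *)
Notation Cplx R := (R[i])^o.

Section smooth_functions.
Context {R : realType} {V W : normedModType R}.

Fixpoint Ck (n : nat) (A : set V) (f : V -> W) : Prop :=
  {in A, continuous f} /\
  if n is m.+1 then
    forall v : V, (forall x, A x -> derivable f x v) /\ Ck m A ('D_v f)
  else True.

(* used for open A only *)
Definition smooth (A : set V) (f : V -> W) : Prop := forall n, Ck n A f.

End smooth_functions.

Definition diffeo {R : realType} {V W : normedModType R}
    (A : set V) (B : set W) (f : V -> W) : Prop :=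
  [/\ smooth A f, set_fun A B f &
    exists g : W -> V, [/\ smooth B g, set_fun B A g,
      {in A, cancel f g} & {in B, cancel g f}]].

Section calculus_on_C.
Context {R : realType}.
Local Notation C := (Cplx R).

Definition sqmod (z : C) : R := complex.Re z ^+ 2 + complex.Im z ^+ 2.

Definition C_of_R2 (t : R * R) : C := t.1 +i* t.2.
Definition R2_of_C (z : C) : R * R := (complex.Re z, complex.Im z).

(* C is not a normed module over R in the library, so real differentiability
   on C is expressed through the coordinates x, y. *)
Definition smoothRC (A : set C) (f : C -> R) : Prop :=
  smooth (C_of_R2 @^-1` A) (f \o C_of_R2).

Definition smoothCC (A : set C) (f : C -> C) : Prop :=
  smoothRC A (fun z => complex.Re (f z)) /\
  smoothRC A (fun z => complex.Im (f z)).

Definition partial (v : R * R) (f : C -> C) (z : C) : C :=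
  'D_v (fun t => complex.Re (f (C_of_R2 t))) (R2_of_C z) +i*
  'D_v (fun t => complex.Im (f (C_of_R2 t))) (R2_of_C z).

Definition d_z (f : C -> C) (z : C) : C :=
  (partial (1, 0) f z - 'i * partial (0, 1) f z) / 2.
Definition d_zbar (f : C -> C) (z : C) : C :=
  (partial (1, 0) f z + 'i * partial (0, 1) f z) / 2.

(* The Laplacian of g |dz|^2; its values are real for real smooth f. *)
Definition laplacian (g f : C -> R) (z : C) : C :=
  (4 / g z)%:C * d_z (d_zbar (fun w => (f w)%:C)) z.

(* K = - (1/2) Delta (log g) *)
Definition curvature (g : C -> R) (z : C) : C :=
  - (laplacian g (fun w => ln (g w)) z / 2).

Definition holomorphic (A : set C) (f : C -> C) : Prop :=
  forall z, A z -> derivable f z 1.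

End calculus_on_C.

Section charts.
Context {R : realType} {S : topologicalType}.
Local Notation C := (Cplx R).

Record chart := Chart {
  cdom : set S;
  cmap : S -> C;
  cinv : C -> S }.

Definition cran (c : chart) : set C := cmap c @` cdom c.

Definition is_chart (c : chart) : Prop :=
  [/\ open (cdom c), open (cran c), {in cdom c, cancel (cmap c) (cinv c)},
    {in cdom c, continuous (cmap c)} & {in cran c, continuous (cinv c)}].

Definition overlap (c d : chart) : set C := cmap c @` (cdom c `&` cdom d).
Definition transition (c d : chart) : C -> C := cmap d \o cinv c.

End charts.
Arguments chart R S : clear implicits.

Record riemannSurface (R : realType) := RiemannSurface {
  surface_sort :> topologicalType;
  atlas : set (chart R surface_sort);
  surface_hausdorff : hausdorff_space surface_sort;
  surface_connected : connected [set: surface_sort];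
  atlas_chart : forall c, atlas c -> is_chart c;
  atlas_cover : forall x, exists c, atlas c /\ cdom c x;
  atlas_holomorphic : forall c d, atlas c -> atlas d ->
    holomorphic (overlap c d) (transition c d) }.

Section geometry.
Context {R : realType} (X : riemannSurface R).
Local Notation C := (Cplx R).

Definition chart_at (x : X) : chart R X := projT1 (cid (atlas_cover x)).

(* h c is the function with h = (h c) |dz|^2 in the chart c. *)
Definition conformal_metric (h : chart R X -> C -> R) : Prop :=
  [/\ forall c z, atlas c -> cran c z -> 0 < h c z,
    forall c, atlas c -> smoothRC (cran c) (h c) &
    forall c d z, atlas c -> atlas d -> overlap c d z ->
      h c z = h d (transition c d z) * sqmod (derive1 (transition c d) z)].

Definition hyperbolic (h : chart R X -> C -> R) : Prop :=
  forall c z, atlas c -> cran c z -> curvature (h c) z = -1.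

(* q c is the function with U = (q c) dz^3 in the chart c. *)
Definition cubic_differential (q : chart R X -> C -> C) : Prop :=
  (forall c, atlas c -> holomorphic (cran c) (q c)) /\
  forall c d z, atlas c -> atlas d -> overlap c d z ->
    q c z = q d (transition c d z) * derive1 (transition c d) z ^+ 3.

(* |U|_h^2; independent of the chart by the transformation laws. *)
Definition sqnormU (h : chart R X -> C -> R) (q : chart R X -> C -> C)
    (x : X) : R :=
  let c := chart_at x in sqmod (q c (cmap c x)) / h c (cmap c x) ^+ 3.

Definition is_small (h : chart R X -> C -> R) (q : chart R X -> C -> C)
    (u : X -> R) : Prop :=
  (exists x, sqnormU h q x != 0) ->
  forall x, u x >= 3^-1 * ln (16 * sup (range (sqnormU h q))).

Definition is_solution (h : chart R X -> C -> R) (q : chart R X -> C -> C)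
    (u : X -> R) : Prop :=
  (forall c, atlas c -> smoothRC (cran c) (u \o cinv c)) /\
  forall c x, atlas c -> cdom c x ->
    laplacian (h c) (u \o cinv c) (cmap c x)
    - (16 * sqnormU h q x * expR (- 2 * u x))%:C
    - (2 * expR (u x))%:C + 2 = 0.

End geometry.

Definition evenly_covered {E B : topologicalType} (p : E -> B) (U : set B) :=
  exists sheets : set (set E),
    [/\ forall V, sheets V -> open V,
      trivIset sheets id,
      \bigcup_(V in sheets) V = p @^-1` U &
      forall V, sheets V -> exists s : B -> E,
        [/\ set_fun U V s, {in U, continuous s},
          {in U, cancel s p} & {in V, cancel p s}]].

Definition covering_map {E B : topologicalType} (p : E -> B) : Prop :=
  [/\ continuous p, forall b, exists e, p e = b &
    forall b, exists U, [/\ open U, U b & evenly_covered p U]].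

Definition deck {E B : topologicalType} (p : E -> B) : set (E -> E) :=
  [set g | exists g' : E -> E, [/\ continuous g, continuous g',
    cancel g g', cancel g' g & forall z, p (g z) = p z]].

Section disc.
Variable R : realType.
Local Notation C := (Cplx R).

Definition disc_set : set C := [set z | `|z| < 1].
Definition disc : Type := set_type disc_set.
HB.instance Definition _ := Topological.on disc.
HB.instance Definition _ := SubType.on disc.

Lemma disc0_subproof : (0 : C) \in disc_set.
Proof. by rewrite inE /disc_set /= normr0 ltr01. Qed.

Definition disc0 : disc := exist _ 0 disc0_subproof.

Definition of_C (z : C) : disc := insubd disc0 z.

End disc.
Arguments disc_set {R}.

Section cover.
Context {R : realType} (X : riemannSurface R) (p : disc R -> X).
Local Notation C := (Cplx R).

(* the derivative at z of the local expression of p in the chart c *)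
Definition cover_deriv (c : chart R X) (z : disc R) : C :=
  derive1 (fun w => cmap c (p (of_C w))) (val z).

Definition universal_cover : Prop :=
  covering_map p /\
  forall c z, atlas c -> cdom c (p z) ->
    derivable (fun w => cmap c (p (of_C w)) : C) (val z) 1.

(* the pull-backs of h and U to the disc are gamma |dz|^2 and Q dz^3 *)
Definition pull_metric (h : chart R X -> C -> R) (z : disc R) : R :=
  let c := chart_at (p z) in
  h c (cmap c (p z)) * sqmod (cover_deriv c z).

Definition pull_cubic (q : chart R X -> C -> C) (z : disc R) : C :=
  let c := chart_at (p z) in q c (cmap c (p z)) * cover_deriv c z ^+ 3.

(* e^u h = 2 s^2 |dz|^2 *)
Definition pull_s (h : chart R X -> C -> R) (u : X -> R) (z : disc R) : R :=
  Num.sqrt (expR (u (p z)) * pull_metric h z / 2).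

End cover.

Section complex_hyperbolic_plane.
Variable R : realType.
Local Notation C := (Cplx R).
Local Notation o0 := (inord 0 : 'I_3).
Local Notation o1 := (inord 1 : 'I_3).
Local Notation o2 := (inord 2 : 'I_3).

Definition herm (u v : 'cV[C]_3) : R[i] :=
  u o0 0 * (v o0 0)^* + u o1 0 * (v o1 0)^* - u o2 0 * (v o2 0)^*.

Definition SU21 : set 'M[C]_3 :=
  [set M | (forall u v, herm (M *m u) (M *m v) = herm u v) /\ \det M = 1].

Definition nonzero : Type := set_type [set v : 'cV[C]_3 | v != 0].
HB.instance Definition _ := Topological.on nonzero.
HB.instance Definition _ := SubType.on nonzero.

Definition collinear (v w : nonzero) : bool :=
  `[< exists k : C, k != 0 /\ val v = k *: val w >].

Lemma collinear_equiv : equiv_class_of collinear.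
Proof.
split.
- by move=> v; apply/asboolP; exists 1; rewrite oner_neq0 scale1r.
- have sym v w : collinear v w -> collinear w v.
    move=> /asboolP[k [k0 vw]]; apply/asboolP; exists k^-1.
    by rewrite invr_eq0 k0 vw scalerA mulVf ?scale1r.
  by move=> v w; apply/idP/idP; exact: sym.
- move=> w v t /asboolP[k [k0 vw]] /asboolP[l [l0 wt]]; apply/asboolP.
  by exists (k * l); rewrite mulf_neq0// vw wt scalerA.
Qed.

Canonical collinear_equivRel := EquivRelPack collinear_equiv.

Definition CP2 : Type := quotient_topology {eq_quot collinear}.
HB.instance Definition _ := Topological.on CP2.
HB.instance Definition _ := Quotient.on CP2.

Lemma e3_subproof :
  (delta_mx o2 0 : 'cV[C]_3) \in [set v : 'cV[C]_3 | v != 0].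
Proof.
rewrite inE /=; apply/eqP => /matrixP /(_ o2 0) /eqP.
by rewrite !mxE !eqxx oner_eq0.
Qed.

Definition e3 : nonzero :=
  exist (fun v => v \in [set v : 'cV[C]_3 | v != 0]) _ e3_subproof.

(* the projection pi; the value at the zero vector is irrelevant *)
Definition cproj (v : 'cV[C]_3) : CP2 := \pi_CP2 (insubd e3 v).

Definition hom_coord (x : CP2) : 'cV[C]_3 := val (repr x).

Definition CP2_act (M : 'M[C]_3) (x : CP2) : CP2 := cproj (M *m hom_coord x).

Definition Wminus : set 'cV[C]_3 := [set v | herm v v < 0].

Definition CH2 : set CP2 := cproj @` Wminus.

(* CH2 lies in the affine chart u_3 <> 0, whose real coordinates are those of
   u_1 / u_3 and u_2 / u_3. *)
Definition affine_coord (x : CP2) : (R * R) * (R * R) :=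
  let v := hom_coord x in
  (R2_of_C (v o0 0 / v o2 0), R2_of_C (v o1 0 / v o2 0)).

Definition normal_disc : set (R * R) := [set t | t.1 ^+ 2 + t.2 ^+ 2 < 2^-1].
Definition normal_cdisc : set (R * R) := [set t | t.1 ^+ 2 + t.2 ^+ 2 <= 2^-1].

(* This formula gives both Phi and its extension to the closed disc. *)
Definition normal_exp (F : disc R -> 'M[C]_3) (z : disc R) (t : R * R) : CP2 :=
  let a := t.1%:C in let b := t.2%:C in
  cproj (('i * a - b) *: col o0 (F z) + ('i * a + b) *: col o1 (F z)
        + col o2 (F z)).

Definition normal_exp_diffeo (F : disc R -> 'M[C]_3) : Prop :=
  (forall z t, normal_disc t -> CH2 (normal_exp F z t)) /\
  diffeo [set y : (R * R) * (R * R) | disc_set (C_of_R2 y.1) /\ normal_disc y.2]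
    (affine_coord @` CH2)
    (fun y => affine_coord (normal_exp F (of_C (C_of_R2 y.1)) y.2)).

Definition normal_exp_closed_injective (F : disc R -> 'M[C]_3) : Prop :=
  forall z z' t t', normal_cdisc t -> normal_cdisc t' ->
    normal_exp F z t = normal_exp F z' t' -> z = z' /\ t = t'.

Definition mx3 (l : seq (seq C)) : 'M[C]_3 :=
  \matrix_(i, j) nth 0 (nth [::] l i) j.

(* c_gamma, for g' = gamma'(z) *)
Definition frame_rot (g' : C) : 'M[C]_3 :=
  let t : C := g' / `|g'| in
  mx3 [:: [:: t; 0; 0]; [:: 0; t^*; 0]; [:: 0; 0; 1]].

Definition disc_deriv (g : disc R -> disc R) (z : disc R) : C :=
  derive1 (fun w => val (g (of_C w)) : C) (val z).

Section frame.
Variables (X : riemannSurface R) (h : chart R X -> C -> R)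
  (q : chart R X -> C -> C) (u : X -> R) (p : disc R -> X).

Local Notation s := (fun w : C => (pull_s p h u (of_C w))%:C : C).
Local Notation Q := (pull_cubic p q).

Definition frame_A (z : disc R) : 'M[C]_3 :=
  let sz := s (val z) in let s_z := d_z s (val z) in
  mx3 [:: [:: sz^-1 * s_z;       0;               sz];
          [:: - Q z * sz ^- 2;   - (sz^-1 * s_z); 0];
          [:: 0;                 sz;              0]].

Definition frame_B (z : disc R) : 'M[C]_3 :=
  let sz := s (val z) in let s_zb := d_zbar s (val z) in
  mx3 [:: [:: - (sz^-1 * s_zb);  (Q z)^* * sz ^- 2;  0];
          [:: 0;                 sz^-1 * s_zb;       sz];
          [:: sz;                0;                  0]].

(* F^-1 dF = A dz + B dzbar, split into its dz and dzbar parts *)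
Definition is_frame (F : disc R -> 'M[C]_3) : Prop :=
  [/\ forall z, SU21 (F z),
    forall i j, smoothCC disc_set (fun w => F (of_C w) i j),
    forall z, invmx (F z) *m
      (\matrix_(i, j) d_z (fun w => F (of_C w) i j) (val z)) = frame_A z &
    forall z, invmx (F z) *m
      (\matrix_(i, j) d_zbar (fun w => F (of_C w) i j) (val z)) = frame_B z].

(* The group pi_1(X) is the group of deck transformations of p. *)
Definition is_holonomy (F : disc R -> 'M[C]_3)
    (rho : (disc R -> disc R) -> 'M[C]_3) : Prop :=
  [/\ forall g, deck p g -> SU21 (rho g),
    forall g g', deck p g -> deck p g' -> rho (g \o g') = rho g *m rho g' &
    forall g z, deck p g ->
      F (g z) = rho g *m F z *m invmx (frame_rot (disc_deriv g z))].

Definition surface_setting (F : disc R -> 'M[C]_3) : Prop :=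
  [/\ compact [set: X],
    conformal_metric h /\ hyperbolic h,
    cubic_differential q,
    is_solution h q u /\ is_small h q u &
    universal_cover p /\ is_frame F].

End frame.

Definition good_bound (kappa : R) : Prop :=
  0 < kappa /\
  forall (X : riemannSurface R) (h : chart R X -> C -> R)
    (q : chart R X -> C -> C) (u : X -> R) (p : disc R -> X)
    (F : disc R -> 'M[C]_3),
  surface_setting h q u p F ->
  (forall x, Num.sqrt (sqnormU h q x) < kappa) ->
  normal_exp_diffeo F /\ normal_exp_closed_injective F.

End complex_hyperbolic_plane.
Arguments CH2 : clear implicits.

(* For Y open in T, closure and interior relative to Y are closure Fd `&` Y and
   Fd°. Openness of Fd is part of the word domain, and excludes sets with empty
   interior, for which the last clause would be void. *)
Definition fundamental_domain {T : topologicalType} {I : Type} (G : set I)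
    (a : I -> T -> T) (Y Fd : set T) : Prop :=
  [/\ open Fd, Fd `<=` Y,
    Y `<=` \bigcup_(g in G) (a g @` (closure Fd `&` Y)) &
    forall g g', G g -> G g' -> g <> g' ->
      (a g @` Fd°) `&` (a g' @` Fd°) = set0].

(* Main.v *)
Require Import Defs.
From HB Require Import structures.
From mathcomp Require Import all_boot all_order all_algebra.
From mathcomp Require Import complex.
From mathcomp Require Import all_classical all_reals all_analysis.
From mathcomp Require Import ring lra.
Import Order.TTheory GRing.Theory Num.Theory.
Import numFieldNormedType.Exports.

Local Open Scope classical_set_scope.
Local Open Scope ring_scope.

(* By equivariance of the normal exponential map Phi, the action of pi_1 on CH2
   covers the action on the disc, up to a rotation of the normal directions.
   Choose an open relatively compact D in the disc that p maps injectively and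
   whose closure p maps onto the surface. As Phi is a homeomorphism, the image
   of D x (open normal disc) is a fundamental domain. Its closure lies in the
   compact image of closure D x (closed normal disc), where the extension of Phi
   is injective, so translates that meet come from translates of closure D that
   meet, and those are finite in number because the deck group acts properly
   discontinuously. The transitivity of the deck group on the fibres of p, which
   gives the covering property, follows by lifting the contraction of the disc. *)

(** * Induction over compact sets *)

Section compactness.
Context {T : topologicalType}.

(** Near-covering compactness is applied to the filter on [set T] whose members contain all
    supersets of some [A] with [P A]; stability of [P] under unions makes it closed under
    intersections. *)
Lemma compact_induction (K : set T) (P : set T -> Prop) : P set0 ->
    (forall A B, A `<=` B -> P B -> P A) ->
    (forall A B, P A -> P B -> P (A `|` B)) ->
    (forall x, K x -> exists2 U, nbhs x U & P U) ->
  compact K -> P K.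
Proof.
move=> P0 Psub PU Ploc /compact_near_coveringP /(_ (set T)
  [set S | exists2 A, P A & forall B, A `<=` B -> S B] (fun B x => B x)) cK.
have [||A PA /(_ A (@subset_refl _ _)) KA] := cK.
- split; first by exists set0.
    move=> S S' [A PA AS] [A' PA' AS']; exists (A `|` A'); first exact: PU.
    by move=> B; rewrite subUset => -[? ?]; split; [exact: AS | exact: AS'].
  by move=> S S' SS' [A PA AS]; exists A => // B /AS /SS'.
- move=> x /Ploc[U xU PU']; exists (U, [set B | U `<=` B]).
    by split => //; exists U.
  by move=> [y B] [/= Uy]; exact.
- exact: Psub KA PA.
Qed.

End compactness.

(** * Covering maps: sheets and uniqueness of lifts *)

Section lifts.
Context {E B : topologicalType} (p : E -> B).
Hypotheses (hE : hausdorff_space E) (cov : covering_map p).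

(** [U] is chosen before the point above it, so that one neighbourhood serves every sheet; homotopy
    lifting and proper discontinuity both rely on this order. *)
Lemma covering_nbhd b : exists U, [/\ open U, U b & forall e, U (p e) ->
  exists V (s : B -> E), [/\ open V, V e & [/\ set_fun U V s, {in U, continuous s},
    {in U, cancel s p} & {in V, cancel p s}]]].
Proof.
have [_ _ /(_ b)[U [oU Ub [sh [osh _ shU hsh]]]]] := cov.
exists U; split => // e Upe.
have : (\bigcup_(V in sh) V) e by rewrite shU.
move=> [V shV Ve]; have [s hs] := hsh _ shV.
by exists V, s; split => //; exact: osh.
Qed.

Lemma covering_sheet e : exists U V (s : B -> E),
  [/\ open U, U (p e), open V, V e & [/\ set_fun U V s, {in U, continuous s},
    {in U, cancel s p} & {in V, cancel p s}]].
Proof.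
have [U [oU Upe /(_ e Upe)[V [s [oV Ve Vs]]]]] := covering_nbhd (p e).
by exists U, V, s.
Qed.

(** The points of [A] where the lifts agree form a relatively open set, because a sheet inverts [p],
    and a relatively closed one, because [E] is Hausdorff. *)
Lemma lift_unique {Y : topologicalType} (A : set Y) (f g : Y -> E) a :
  connected A -> {in A, continuous f} -> {in A, continuous g} ->
  (forall y, A y -> p (f y) = p (g y)) -> A a -> f a = g a ->
  forall y, A y -> f y = g y.
Proof.
move=> conA cf cg pfg Aa fga.
have loc_eq x : A x -> f x = g x -> \near x, A x -> f x = g x.
  move=> Ax fgx; have [U [V [s [_ _ oV Vf [_ _ _ ps]]]]] := covering_sheet (f x).
  have Ef : \near x, V (f x).
    by apply: cf; [rewrite inE | apply: open_nbhs_nbhs].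
  have Eg : \near x, V (g x).
    by apply: cg; [rewrite inE | rewrite -fgx; apply: open_nbhs_nbhs].
  near=> y => Ay; rewrite -[LHS]ps; last by rewrite inE; near: y.
  by rewrite pfg// ps// inE; near: y.
have loc_neq x : A x -> f x <> g x -> \near x, A x -> f x <> g x.
  move=> Ax fgx; have := hE; rewrite open_hausdorff => /(_ (f x) (g x)).
  case; first exact/eqP.
  move=> [V W] /= [Vf Wg] [oV oW VW0].
  have Ef : \near x, V (f x).
    apply: cf; [by rewrite inE | by apply: open_nbhs_nbhs; split => //; move: Vf; rewrite inE].
  have Eg : \near x, W (g x).
    apply: cg; [by rewrite inE | by apply: open_nbhs_nbhs; split => //; move: Wg; rewrite inE].
  near=> y => Ay fgy.
  have : (V `&` W) (f y) by split; [near: y | rewrite fgy; near: y].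
  by move/eqP: VW0 => ->.
(* Connectedness is used in this form: a nonempty subset of [A] that is the trace of an open set and
   of a closed set is all of [A]. *)
suff <- : [set y | A y /\ f y = g y] = A by move=> y [].
apply: conA; first by exists a.
- exists (interior [set y | A y -> f y = g y]); first exact: open_interior.
  apply/seteqP; split=> y /=; last by move=> [Ay /nbhs_singleton /(_ Ay)].
  by move=> [Ay fgy]; split => //; exact: loc_eq.
- exists (~` interior [set y | A y -> f y <> g y]).
    by apply: open_closedC; exact: open_interior.
  apply/seteqP; split=> y /=.
    by move=> [Ay fgy]; split => // /nbhs_singleton /(_ Ay).
  move=> [Ay nfgy]; split => //; apply: contrapT => fgy; apply: nfgy.
  exact: loc_neq.
Unshelve. all: by end_near.
Qed.

End lifts.

(** * Continuity: local changes and product spaces *)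

Lemma near_eq_continuous {S T : topologicalType} (f g : S -> T) x :
  (\near x, f x = g x) -> {for x, continuous f} -> {for x, continuous g}.
Proof.
move=> fg cf; rewrite /prop_for /continuous_at -(nbhs_singleton fg).
by apply: cvg_trans cf; exact: near_eq_cvg.
Qed.

Lemma continuous_comp_fst {S T U : topologicalType} (f : S -> T * U) x :
  {for x, continuous f} -> {for x, continuous (fun y => (f y).1)}.
Proof. by move=> cf; apply: continuous_comp cf _; exact: cvg_fst. Qed.

Lemma continuous_comp_snd {S T U : topologicalType} (f : S -> T * U) x :
  {for x, continuous f} -> {for x, continuous (fun y => (f y).2)}.
Proof. by move=> cf; apply: continuous_comp cf _; exact: cvg_snd. Qed.

Lemma continuous_pairr {S T U : topologicalType} (L : S * T -> U) y t :
  {for (y, t), continuous L} -> {for t, continuous (fun t' => L (y, t'))}.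
Proof.
move=> cL; apply: (@continuous_comp _ _ _ (fun t' => (y, t')) L) => //.
by apply: cvg_pair; [exact: cvg_cst | exact: cvg_id].
Qed.

Lemma continuous_pairl {S T U : topologicalType} (L : S * T -> U) y t :
  {for (y, t), continuous L} -> {for y, continuous (fun y' => L (y', t))}.
Proof.
move=> cL; apply: (@continuous_comp _ _ _ (fun y' => (y', t)) L) => //.
by apply: cvg_pair; [exact: cvg_id | exact: cvg_cst].
Qed.

(** * Homotopy lifting for coverings *)

Section homotopy_lifting.
Context {R : realType} {E B Y : topologicalType} (p : E -> B).
Hypotheses (hE : hausdorff_space E) (cov : covering_map p).
Variables (K : Y * R -> B) (e1 : E).
Hypotheses (cK : continuous K) (K0 : forall y t, t <= 0 -> K (y, t) = p e1).

(** Time runs over the whole line, and [K] is constant for [t <= 0]. Prescribing the value [e1]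
    there makes partial lifts unique where they are jointly defined. *)
Let partial_lift (N : set Y) (tau : R) (L : Y * R -> E) :=
  forall y t, N y -> t < tau -> [/\ {for (y, t), continuous L},
    p (L (y, t)) = K (y, t) & t <= 0 -> L (y, t) = e1].

Let liftable y tau := exists N L, [/\ open N, N y & partial_lift N tau L].

Let partial_lift_unique N N' tau tau' L L' y t :
  partial_lift N tau L -> partial_lift N' tau' L' -> N y -> N' y ->
  t < tau -> t < tau' -> L (y, t) = L' (y, t).
Proof.
move=> lL lL' Ny N'y ttau ttau'.
(* The time [Num.min 0 t] lies below both bounds and is nonpositive, so both lifts equal [e1]
   there. *)
apply: (lift_unique p hE cov `]-oo, Num.min tau tau'[ (fun t => L (y, t))
  (fun t => L' (y, t)) (Num.min 0 t)).
- by apply/connected_intervalP; exact: interval_is_interval.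
- move=> x; rewrite inE /= in_itv /= lt_min => /andP[x1 x2].
  by apply: continuous_pairr; have [] := lL y x Ny x1.
- move=> x; rewrite inE /= in_itv /= lt_min => /andP[x1 x2].
  by apply: continuous_pairr; have [] := lL' y x N'y x2.
- move=> x; rewrite /= in_itv /= lt_min => /andP[x1 x2].
  by have [_ -> _] := lL y x Ny x1; have [_ -> _] := lL' y x N'y x2.
- by rewrite /= in_itv /= lt_min !gt_min ttau ttau' !orbT.
- have m0 : Num.min 0 t <= 0 by rewrite ge_min lexx.
  have mt : Num.min 0 t < tau by rewrite gt_min ttau orbT.
  have mt' : Num.min 0 t < tau' by rewrite gt_min ttau' orbT.
  have [_ _ ->//] := lL y _ Ny mt; by have [_ _ ->] := lL' y _ N'y mt'.
- by rewrite /= in_itv /= lt_min ttau ttau'.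
Qed.

(** The gain [e] depends on [y] and [tau] only, not on the time already reached; this lets the step
    cross a supremum. *)
Let liftable_step y tau : exists2 e : R, 0 < e &
  forall t, liftable y t -> tau - e < t -> liftable y (tau + e).
Proof.
have [U [oU Ub sheet]] := covering_nbhd p cov (K (y, tau)).
have /cK [[P Q] /= [yP tQ] PQ] : nbhs (K (y, tau)) U by exact: open_nbhs_nbhs.
have [e /= e0 eQ] := tQ; exists e => //.
have KU y' t : P y' -> tau - e < t -> t < tau + e -> U (K (y', t)).
  move=> Py' t1 t2; apply: (PQ (y', t)); split => //=; apply: eQ => /=.
  by rewrite ltr_distlC t1 t2.
move=> sg [N [L [oN Ny lL]]] sgt.
have [le_sg|sg_lt] := leP (tau + e) sg.
  by exists N, L; split => // y' t Ny' tt; apply: lL => //; exact: lt_le_trans le_sg.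
(* The old lift reaches [sg]. The sheet is chosen at time [t0] and the lift switches to it at [t1],
   which leaves an overlap on both sides of [t1]. *)
pose t0 := (tau - e + sg) / 2; pose t1 := (t0 + sg) / 2.
have t0l : tau - e < t0 by rewrite /t0; lra.
have t01 : t0 < t1 by rewrite /t1 /t0; lra.
have t1s : t1 < sg by rewrite /t1 /t0; lra.
have Py : P y by exact: nbhs_singleton.
have [ct0 pt0 _] := lL y t0 Ny (lt_trans t01 t1s).
have [|V [s [oV Vt0 [sUV cs sp ps]]]] := sheet (L (y, t0)).
  by rewrite pt0; apply: KU => //; lra.
(* Shrinking [N] keeps all values at time [t0] in the single sheet [V]. *)
pose N' := N `&` P° `&` [set y' | V (L (y', t0))]°.
have VL : nbhs y [set y' | V (L (y', t0))].
  by apply: (continuous_pairl L _ _ ct0 V); exact: open_nbhs_nbhs.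
have oN' : open N' by apply: openI; [apply: openI => //|]; exact: open_interior.
have N'y : N' y by [].
have csK y' t : P y' -> tau - e < t -> t < tau + e ->
    {for (y', t), continuous (s \o K)}.
  by move=> *; apply: continuous_comp; [exact: cK | apply: cs; rewrite inE; exact: KU].
have eqL y' t : N' y' -> tau - e < t -> t < sg -> L (y', t) = s (K (y', t)).
  move=> [[Ny' /interior_subset Py'] /interior_subset Vy'] h1 h2.
  apply: (lift_unique p hE cov `]tau - e, sg[ (fun t => L (y', t))
    (fun t => s (K (y', t))) t0).
  - by apply/connected_intervalP; exact: interval_is_interval.
  - move=> x; rewrite inE /= in_itv /= => /andP[x1 x2].
    by apply: continuous_pairr; have [] := lL y' x Ny' x2.
  - move=> x; rewrite inE /= in_itv /= => /andP[x1 x2].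
    by apply: (continuous_pairr (s \o K)); apply: csK => //; lra.
  - move=> x; rewrite /= in_itv /= => /andP[x1 x2].
    have [_ -> _] := lL y' x Ny' x2; rewrite sp// inE; apply: KU => //; lra.
  - by rewrite /= in_itv /= t0l; lra.
  - have [_ <- _] := lL y' t0 Ny' (lt_trans t01 t1s).
    by rewrite ps// inE.
  - by rewrite /= in_itv /= h1.
(* The two formulas agree for times in []tau - e, sg[], so [L'] coincides with one of them near
   every point. *)
pose L' (z : Y * R) := if z.2 < t1 then L z else s (K z).
exists N', L'; split => // y' t Ny' tte.
have [[NNy' /interior_subset Py'] /interior_subset Vy'] := Ny'.
have nN : nbhs y' N' by exact: open_nbhs_nbhs.
split.
- have [tsg|sgt'] := ltP t sg.
    apply: (near_eq_continuous L); last by have [] := lL y' t NNy' tsg.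
    exists (N', `]-oo, sg[%classic) => /=.
      split => //; apply: open_nbhs_nbhs; split; last by rewrite /= in_itv.
      exact: interval_open.
    move=> [y2 t2] [/= Ny2]; rewrite in_itv /= => t2s; rewrite /L' /=.
    by case: ltP => // ht; apply: eqL => //; lra.
  apply: (near_eq_continuous (s \o K)); last by apply: csK => //; lra.
  exists (N', `]t0, +oo[%classic) => /=.
    split => //; apply: open_nbhs_nbhs; split; last by rewrite /= in_itv /= andbT; lra.
    exact: interval_open.
  move=> [y2 t2] [/= Ny2]; rewrite in_itv /= andbT => t2s; rewrite /L' /=.
  by case: ltP => // ht; rewrite eqL//; lra.
- rewrite /L' /=; case: ltP => ht; first by have [] := lL y' t NNy' (lt_trans ht t1s).
  by rewrite sp// inE; apply: KU => //; lra.
- rewrite /L' /= => t_le0; case: ltP => ht.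
    by have [_ _ ->] := lL y' t NNy' (lt_trans ht t1s).
  (* Here [t1 <= t <= 0], so [K] takes the value [p e1] at both times, and the sheet gives at [t]
     the value of [L] at [t1]. *)
  have [_ _ <-] := lL y' t1 NNy' t1s; last by lra.
  by rewrite eqL// ?K0//; lra.
Qed.

(** The liftable times form a down-closed set containing [0]; if it were bounded, the extension step
    taken just below its supremum would pass beyond it. *)
Let liftable_all y tau : liftable y tau.
Proof.
apply: contrapT => ntau; pose T := [set t | liftable y t].
have downT t t' : t <= t' -> T t' -> T t.
  move=> tt' [N [L [oN Ny lL]]]; exists N, L; split => // y' x Ny' xt.
  by apply: lL => //; exact: lt_le_trans tt'.
have T0 : T 0.
  exists setT, (fun _ => e1); split => //; first exact: openT.
  move=> y' t _ t0; split => //; first exact: cvg_cst.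
  by rewrite K0// ltW.
have ubT : ubound T tau.
  by move=> t Tt; rewrite leNgt; apply/negP => /ltW /downT /(_ Tt).
have hT : has_sup T by split; [exists 0 | exists tau].
have [e e0 he] := liftable_step y (sup T).
have [t Tt ht] := sup_adherent e0 hT.
have /(ub_le_sup (ex_intro _ tau ubT)) := he t Tt ht.
by lra.
Qed.

(** For each point a partial lift reaching one time unit beyond it is chosen. Uniqueness makes the
    choices agree on overlaps, so evaluating each at its own point gives a continuous map. *)
Lemma homotopy_lift : exists L : Y * R -> E,
  [/\ continuous L, forall z, p (L z) = K z & forall y t, t <= 0 -> L (y, t) = e1].
Proof.
have [NL hNL] := choice (fun z : Y * R => let: ex_intro N (ex_intro L h) :=
  liftable_all z.1 (z.2 + 1) in ex_intro (fun NL : set Y * (Y * R -> E) =>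
  [/\ open NL.1, NL.1 z.1 & partial_lift NL.1 (z.2 + 1) NL.2]) (N, L) h).
pose L z := (NL z).2 z; exists L.
have lt1 (t : R) : t < t + 1 by lra.
split.
- move=> [y t]; have [oN Ny lL] := hNL (y, t).
  apply: (near_eq_continuous (NL (y, t)).2); last by have [] := lL y t Ny (lt1 t).
  exists ((NL (y, t)).1, `]-oo, t + 1[%classic) => /=.
    split; first exact: open_nbhs_nbhs.
    apply: open_nbhs_nbhs; split; last by rewrite /= in_itv /= lt1.
    exact: interval_open.
  move=> [y2 t2] [/= Ny2]; rewrite in_itv /= => t2s; rewrite /L.
  have [_ Ny2' lL2] := hNL (y2, t2).
  exact: (partial_lift_unique _ _ _ _ _ _ _ _ lL lL2).
- by move=> [y t]; have [oN Ny lL] := hNL (y, t); have [] := lL y t Ny (lt1 t).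
- by move=> y t t0; have [oN Ny lL] := hNL (y, t); have [_ _] := lL y t Ny (lt1 t); exact.
Qed.

End homotopy_lifting.

(** * Deck groups of coverings with contractible total space *)

Definition contraction {R : realType} {E : topologicalType} (e0 : E)
    (H : E * R -> E) : Prop :=
  [/\ continuous H, forall y t, t <= 0 -> H (y, t) = e0,
    forall y, H (y, 1) = y & forall t, H (e0, t) = e0].

Lemma connected_setT_real {R : realType} : connected [set: R].
Proof. by rewrite -set_itvNyy; apply/connected_intervalP; exact: interval_is_interval. Qed.

(** [A] is the union of the paths of [H] attached to its points, all of which pass through [e0] at
    time [0]. *)
Lemma contraction_star_connected {R : realType} {E : topologicalType} (e0 : E)
    (H : E * R -> E) (A : set E) : contraction e0 H -> A e0 ->
  (forall y t, A y -> A (H (y, t))) -> connected A.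
Proof.
move=> [cH H0 H1 _] Ae0 HA.
have -> : A = \bigcup_(y in A) ((fun t => H (y, t)) @` [set: R]).
  apply/seteqP; split => [y Ay|_ [y Ay [t _ <-]]]; last exact: HA.
  by exists y => //; exists 1.
apply: bigcup_connected; first by exists e0 => y _; exists 0; rewrite ?H0.
move=> y _; apply: connected_continuous_connected; first exact: connected_setT_real.
by apply: continuous_subspaceT => t; apply: continuous_pairr; exact: cH.
Qed.

Section deck_group.
Context {R : realType} {E B : topologicalType} (p : E -> B).
Hypotheses (hE : hausdorff_space E) (cov : covering_map p).
Hypothesis contr : forall e0 : E, exists H : E * R -> E, contraction e0 H.

Lemma contraction_connected (e0 : E) : connected [set: E].
Proof.
by have [H cH] := contr e0; exact: (contraction_star_connected e0 H setT cH).
Qed.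

(** The map [p \o H] is lifted with starting value [e2] instead of [e1], and [g] is the lift at time
    [1]. As [H] fixes [e1] at all times, uniqueness keeps the lift along [e1] constant, so
    [g e1 = e2]. *)
Lemma lift_based e1 e2 : p e1 = p e2 ->
  exists g : E -> E, [/\ continuous g, forall y, p (g y) = p y & g e1 = e2].
Proof.
move=> pe; have [H [cH H0 H1 He]] := contr e1.
have cp : continuous p by case: cov.
have [||L [cL pL L0]] := @homotopy_lift R E B E p hE cov (p \o H) e2.
- by move=> z; apply: continuous_comp; [exact: cH | exact: cp].
- by move=> y t t0 /=; rewrite H0.
exists (fun y => L (y, 1)); split.
- by move=> y; apply: continuous_pairl; exact: cL.
- by move=> y; rewrite pL /= H1.
- apply: (lift_unique p hE cov setT (fun t => L (e1, t)) (fun=> e2) 0) => //.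
  + exact: connected_setT_real.
  + by move=> t _; apply: continuous_pairr; exact: cL.
  + by move=> t _; exact: cvg_cst.
  + by move=> t _; rewrite pL /= He.
  + exact: L0.
Qed.

(** The based lifts in the two directions are mutually inverse, since each composite and the
    identity lift [p] and agree at a base point. *)
Lemma deck_transitive e1 e2 : p e1 = p e2 -> exists2 g, deck p g & g e1 = e2.
Proof.
move=> pe; have [g [cg pg ge]] := lift_based _ _ pe.
have [g' [cg' pg' ge']] := lift_based _ _ (esym pe).
have cc (f1 f2 : E -> E) : continuous f1 -> continuous f2 -> continuous (f1 \o f2).
  by move=> c1 c2 y; apply: continuous_comp; [exact: c2 | exact: c1].
exists g => //; exists g'; split => // y.
- apply: (lift_unique p hE cov setT (g' \o g) id e1) => //=.
  + exact: (contraction_connected e1).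
  + by move=> x _; exact: cc.
  + by move=> x _; exact: cvg_id.
  + by move=> x _; rewrite pg' pg.
  + by rewrite ge.
- apply: (lift_unique p hE cov setT (g \o g') id e2) => //=.
  + exact: (contraction_connected e1).
  + by move=> x _; exact: cc.
  + by move=> x _; exact: cvg_id.
  + by move=> x _; rewrite pg pg'.
  + by rewrite ge'.
Qed.

Lemma deck_unique g g' a : deck p g -> deck p g' -> g a = g' a -> g = g'.
Proof.
move=> [g1 [cg _ _ _ pg]] [g1' [cg' _ _ _ pg']] ga; apply/funext => y.
apply: (lift_unique p hE cov setT g g' a) => //.
- exact: (contraction_connected a).
- by move=> x _; rewrite pg pg'.
Qed.

Hypothesis hB : hausdorff_space B.
Hypothesis loc_conn : forall (x : E) N, nbhs x N ->
  exists A, [/\ nbhs x A, A `<=` N & connected A].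

(** Compact induction on the square of [K] counts the deck transformations whose graph meets a given
    set. Near [(x, y)] there are none if [p x] and [p y] differ, and otherwise at most the one
    taking [x] to [y]. *)
Lemma deck_properly_discontinuous (K : set E) : compact K ->
  finite_set [set g | deck p g /\ exists2 a, K a & K (g a)].
Proof.
move=> cptK; have cp : continuous p by case: cov.
suff : finite_set [set g | deck p g /\ exists a, (K `*` K) (a, g a)].
  apply: sub_finite_set => g [dg [a Ka Kga]]; split => //; by exists a.
apply: (compact_induction (K `*` K) (fun S : set (E * E) =>
  finite_set [set g | deck p g /\ exists a, S (a, g a)]) _ _ _ _
  (compact_setX cptK cptK)).
- by apply: sub_finite_set (finite_set0 _) => g [_ [a []]].
- move=> A C AC; apply: sub_finite_set => g [dg [a Aa]]; split => //.
  by exists a; exact: AC.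
- move=> A C fA fC; apply: sub_finite_set (_ : finite_set (_ `|` _)); last first.
    by rewrite finite_setU; split; [exact: fA | exact: fC].
  by move=> g [dg [a [Aa|Ca]]]; [left|right]; split => //; exists a.
move=> [x y] _.
have [pxy|pxy] := pselect (p x = p y); last first.
  have := hB; rewrite open_hausdorff => /(_ (p x) (p y)).
  case; first exact/eqP.
  move=> [V W] /= [Vx Wy] [oV oW /eqP VW0]; rewrite !inE in Vx Wy.
  exists ((p @^-1` V) `*` (p @^-1` W)).
    exists (p @^-1` V, p @^-1` W) => //=; split; apply: cp; exact: open_nbhs_nbhs.
  apply: sub_finite_set (finite_set0 _) => g [[_ [_ _ _ _ pg]] [a [/= Va Wa]]].
  have : (V `&` W) (p a) by split; [exact: Va | rewrite -pg].
  by rewrite VW0.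
have [U [oU Upx sheet]] := covering_nbhd p cov (p x).
have [V [s [oV Vy [_ cs sp ps]]]] := sheet y ltac:(by rewrite -pxy).
have [A [xA AU cA]] := loc_conn x (p @^-1` U) (cp x U (open_nbhs_nbhs (conj oU Upx))).
exists (A `*` V).
  by exists (A, V) => //=; split => //; exact: open_nbhs_nbhs.
(* On the connected neighbourhood [A] of [x] the map [g] coincides with [s \o p], because [g a] lies
   in the sheet [V]; hence [g x = s (p y) = y]. *)
have gx g : deck p g -> (exists a, (A `*` V) (a, g a)) -> g x = y.
  move=> [_ [cg _ _ _ pg]] [a [/= Aa Vga]].
  rewrite -[RHS]ps ?inE// -pxy.
  apply: (lift_unique p hE cov A g (s \o p) a) => //.
  - move=> z; rewrite inE => Az; apply: continuous_comp; first exact: cp.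
    by apply: cs; rewrite inE; exact: AU.
  - by move=> z Az; rewrite /= sp ?inE ?pg//; exact: AU.
  - by rewrite /= -[LHS]ps ?inE// pg.
  - exact: nbhs_singleton.
have [[g0 [dg0 g0x]]|no] := pselect (exists g, deck p g /\ g x = y).
  apply: (@sub_finite_set _ _ [set g0]); last exact: finite_set1.
  by move=> g [dg /(gx g dg) gxy] /=; apply: (deck_unique _ _ x) => //; rewrite gxy.
apply: (@sub_finite_set _ _ set0); last exact: finite_set0.
by move=> g [dg /(gx g dg) gxy] /=; apply: no; exists g.
Qed.

End deck_group.

(** * A relatively compact open transversal of the covering *)

Section transversal.
Context {E B : topologicalType} (p : E -> B).
Hypotheses (cov : covering_map p) (hB : hausdorff_space B).
Hypothesis loc_cpt : forall (x : E) N, nbhs x N ->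
  exists A, [/\ open A, A x, A `<=` N & compact (closure A)].

Let good (D : set E) :=
  [/\ open D, compact (closure D) & {in D &, injective p}].

(** Compact induction over the base: small sets inside sheets solve the problem locally, and two
    partial transversals can be merged. *)
Lemma covering_transversal : compact [set: B] ->
  exists D, good D /\ p @` closure D = setT.
Proof.
have cp : continuous p by case: cov.
move=> cB; suff [D [gD sD]] : exists D, good D /\ setT `<=` p @` closure D.
  by exists D; split => //; apply/seteqP; split.
have cpt_img D : compact (closure D) -> compact (p @` closure D).
  by move=> cD; apply: continuous_compact => //; exact: continuous_subspaceT.
apply: (compact_induction setT (fun S => exists D, good D /\ S `<=` p @` closure D)
  _ _ _ _ cB).
- exists set0; split; last by [].
  split; first exact: open0.
    by rewrite closure0; exact: compact0.
  by move=> x y; rewrite inE.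
- by move=> A C AC [D [gD CD]]; exists D; split => //; exact: subset_trans CD.
- move=> A1 A2 [D1 [[oD1 cD1 iD1] AD1]] [D2 [[oD2 cD2 iD2] AD2]].
  have clF : closed (p @` closure D1) by apply: compact_closed => //; exact: cpt_img.
  pose O := p @^-1` (~` (p @` closure D1)).
  have oO : open O by move/continuousP: cp; apply; exact: closed_openC.
  (* Only the part of D2 not already covered by the closure of D1 is added. *)
  exists (D1 `|` (D2 `&` O)); split.
    split.
    + by apply: openU => //; exact: openI.
    + rewrite closureU.
      apply: compactU => //.
      apply: (subclosed_compact _ cD2); first exact: closed_closure.
      by apply: closureS; exact: subIsetl.
    + have D12 x y : D1 x -> (D2 `&` O) y -> p x <> p y.
        move=> D1x [_ Oy] pxy; apply: Oy; exists x => //.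
        exact: subset_closure.
      move=> x y; rewrite !inE => -[Dx|Dx] [Dy|Dy] pxy.
      * by apply: iD1 => //; rewrite inE.
      * by case: (D12 x y).
      * by case: (D12 y x).
      * by case: Dx Dy => [Dx _] [Dy _]; apply: iD2 => //; rewrite inE.
  move=> b A12b; rewrite closureU image_setU.
  have [F1b|nF1b] := pselect ((p @` closure D1) b); first by left.
  right; case: A12b => [/AD1//|/AD2[w D2w pw]]; exists w => //.
  (* A point [w] of the closure of [D2] over a point not yet covered lies in the open set [O], so
     the points of [D2] close to it survive the removal. *)
  move=> N wN; have Ow : O w by rewrite /O /= pw.
  have /(D2w (N `&` O))[z [D2z [Nz Oz]]] : nbhs w (N `&` O).
    by apply: filterI => //; exact: open_nbhs_nbhs.
  by exists z.
- move=> b _; have [_ /(_ b)[e <-] _] := cov.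
  have [U [V [s [oU Upe oV Ve [_ cs sp ps]]]]] := covering_sheet p cov e.
  have [D [oD De DV cD]] := loc_cpt e V (open_nbhs_nbhs (conj oV Ve)).
  have spe : s (p e) = e by rewrite ps// inE.
  exists (U `&` s @^-1` D).
    apply: filterI; first exact: open_nbhs_nbhs.
    by apply: cs; rewrite ?inE// spe; exact: open_nbhs_nbhs.
  exists D; split.
    split => // x y; rewrite !inE => Dx Dy pxy.
    by rewrite -[x]ps ?pxy ?ps ?inE//; exact: DV.
  move=> b' [Ub' Dsb']; exists (s b'); last by rewrite sp// inE.
  exact: subset_closure.
Qed.

End transversal.

(** * Continuity in subspaces *)

Section subtype_continuity.
Context {T : topologicalType} (A : set T).

Lemma continuous_val : continuous (val : set_type A -> T).
Proof. exact: initial_continuous. Qed.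

Lemma nbhs_set_type (x : set_type A) (N : set (set_type A)) : nbhs x N ->
  exists2 M : set T, nbhs (val x) M & forall y, M (val y) -> N y.
Proof.
move=> [V [[W oW <-] Wx WN]]; exists W; first exact: open_nbhs_nbhs.
by move=> y Wy; exact: WN.
Qed.

Lemma continuous_into_set_type {S : topologicalType} (f : S -> set_type A) x :
  {for x, continuous (fun y => val (f y))} -> {for x, continuous f}.
Proof.
move=> cf N /nbhs_set_type[M /cf xM MN]; rewrite nbhs_simpl /=.
by apply: (@filterS _ (nbhs x) _ _ _ _ xM) => y /MN.
Qed.

End subtype_continuity.

(** * The complex plane in real coordinates *)

Section plane_coordinates.
Context {R : realType}.
Local Notation C := (Cplx R).

Lemma continuous_Re : continuous (fun z : C => complex.Re z).
Proof.
move=> z N /nbhs_ballP[e /= e0 eN]; apply/nbhs_ballP.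
(* Balls of [Cplx R] have complex radii, so the real radius is embedded. *)
exists (e%:C)%C; first by rewrite /= ltcR.
move=> w; rewrite -ball_normE /= => zw; apply: eN; rewrite -ball_normE /= -ltcR.
apply: le_lt_trans zw; have := normc_ge_Re (z - w).
by case: z w => ? ? [? ?].
Qed.

Lemma continuous_Im : continuous (fun z : C => complex.Im z).
Proof.
move=> z N /nbhs_ballP[e /= e0 eN]; apply/nbhs_ballP.
exists (e%:C)%C; first by rewrite /= ltcR.
move=> w; rewrite -ball_normE /= => zw; apply: eN; rewrite -ball_normE /= -ltcR.
apply: le_lt_trans zw; rewrite [leRHS]normc_def lecR.
have -> : complex.Im z - complex.Im w = complex.Im (z - w) by case: z w => ? ? [? ?].
by rewrite -sqrtr_sqr ler_wsqrtr// lerDr sqr_ge0.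
Qed.

Lemma continuous_R2_of_C : continuous (@R2_of_C R).
Proof.
move=> z; have cR := continuous_Re z; have cI := continuous_Im z.
exact: (cvg_pair cR cI).
Qed.

Lemma continuous_C_of_R2 : continuous (@C_of_R2 R).
Proof.
move=> t N /nbhs_ballP[e /= e0 eN].
(* A positive complex radius is real. *)
have [eR e0'] : e = ((complex.Re e)%:C)%C /\ 0 < complex.Re e.
  by move: e0; rewrite ltcE /= => /andP[/eqP]; case: e {eN} => ? ? /= -> ->.
(* Coordinates bounded by half the radius give a modulus below the radius. *)
apply/nbhs_ballP; exists (complex.Re e / 2) => /=; first by rewrite divr_gt0.
move=> s []; rewrite -!ball_normE /= => h1 h2; apply: eN.
rewrite -ball_normE /= eR [X in X < _]normc_def ltcR.
rewrite /= in h1 h2 *; set r := complex.Re e in e0' h1 h2 *.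
rewrite -[ltRHS](ger0_norm (ltW e0')) -sqrtr_sqr ltr_sqrt ?exprn_gt0//.
move: h1 h2; rewrite !ltr_norml => /andP[a1 a2] /andP[b1 b2].
have := mulr_gt0 (_ : 0 < r / 2 - (t.1 - s.1)) (_ : 0 < r / 2 + (t.1 - s.1)).
have := mulr_gt0 (_ : 0 < r / 2 - (t.2 - s.2)) (_ : 0 < r / 2 + (t.2 - s.2)).
move=> /(_ ltac:(lra) ltac:(lra)) h1 /(_ ltac:(lra) ltac:(lra)) h2.
nra.
Qed.

Lemma C_of_R2K (z : C) : C_of_R2 (R2_of_C z) = z.
Proof. by case: z. Qed.

Lemma R2_of_CK (t : R * R) : R2_of_C (C_of_R2 t) = t.
Proof. by case: t. Qed.

Lemma disc_set_C_of_R2 (t : R * R) :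
  disc_set (C_of_R2 t) <-> t.1 ^+ 2 + t.2 ^+ 2 < 1.
Proof.
rewrite /disc_set /= normc_def /= -[1](_ : (1%:C)%C = 1)// ltcR.
by rewrite -[X in _ < X]sqrtr1 ltr_sqrt.
Qed.

End plane_coordinates.

(** * Topology of the unit disc: contractions and local properties *)

Section disc_topology.
Context {R : realType}.
Local Notation C := (Cplx R).

Definition disc_coord (z : disc R) : R * R := R2_of_C (val z).
Definition disc_of_coord (t : R * R) : disc R := of_C (C_of_R2 t).

Lemma disc_val (z : disc R) : disc_set (val z).
Proof. by have := valP z; rewrite inE. Qed.

Lemma val_of_C (z : C) : disc_set z -> val (of_C z) = z.
Proof. by move=> zD; apply: insubdK; rewrite /= inE. Qed.

Lemma of_C_val (z : disc R) : of_C (val z) = z.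
Proof. by apply: val_inj; rewrite val_of_C//; exact: disc_val. Qed.

Lemma disc_coordK : cancel disc_coord disc_of_coord.
Proof. by move=> z; rewrite /disc_of_coord C_of_R2K of_C_val. Qed.

Lemma disc_of_coordK (t : R * R) : t.1 ^+ 2 + t.2 ^+ 2 < 1 ->
  disc_coord (disc_of_coord t) = t.
Proof.
by move=> /disc_set_C_of_R2 tD; rewrite /disc_coord /disc_of_coord val_of_C// R2_of_CK.
Qed.

Lemma disc_coord_lt1 (z : disc R) : (disc_coord z).1 ^+ 2 + (disc_coord z).2 ^+ 2 < 1.
Proof. by apply/disc_set_C_of_R2; rewrite C_of_R2K; exact: disc_val. Qed.

Lemma continuous_disc_coord : continuous disc_coord.
Proof.
by move=> z; apply: continuous_comp; [exact: continuous_val | exact: continuous_R2_of_C].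
Qed.

Lemma open_unit_disc : open [set t : R * R | t.1 ^+ 2 + t.2 ^+ 2 < 1].
Proof.
apply: (@open_comp _ _ (fun t : R * R => t.1 ^+ 2 + t.2 ^+ 2) [set x | x < 1]); last exact: open_lt.
move=> t _; apply: cvgD; apply: cvgM;
  by [exact: cvg_fst | exact: cvg_snd].
Qed.

Lemma continuous_disc_of_coord (t : R * R) : t.1 ^+ 2 + t.2 ^+ 2 < 1 ->
  {for t, continuous disc_of_coord}.
Proof.
move=> tD; apply: continuous_into_set_type.
apply: (near_eq_continuous (@C_of_R2 R)); last exact: continuous_C_of_R2.
have := open_nbhs_nbhs (conj open_unit_disc tD); apply: filterS => s sD.
by rewrite /disc_of_coord val_of_C//; apply/disc_set_C_of_R2.
Qed.

Lemma disc_hausdorff : hausdorff_space (disc R).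
Proof.
move=> z w zw; apply: (can_inj disc_coordK); apply: (@norm_hausdorff _ (R * R)%type) => U V zU wV.
have [y [Uy Vy]] := zw _ _ (continuous_disc_coord z U zU) (continuous_disc_coord w V wV).
by exists (disc_coord y).
Qed.

Let sqdist (t s : R * R) : R := (t.1 - s.1) ^+ 2 + (t.2 - s.2) ^+ 2.

Let continuous_sqdist s : continuous (sqdist^~ s).
Proof.
move=> t; have h1 : {for t, continuous (fun t : R * R => t.1 - s.1)}.
  by apply: cvgB; [exact: cvg_fst | exact: cvg_cst].
have h2 : {for t, continuous (fun t : R * R => t.2 - s.2)}.
  by apply: cvgB; [exact: cvg_snd | exact: cvg_cst].
by apply: cvgD; apply: cvgM.
Qed.

Let open_sqball c r : open [set y | sqdist (disc_coord y) c < r].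
Proof.
apply: (@open_comp _ _ (sqdist^~ c \o disc_coord) [set x | x < r]); last exact: open_lt.
move=> y _; apply: continuous_comp; first exact: continuous_disc_coord.
exact: continuous_sqdist.
Qed.

(** Contractions are parametrised by all real times; truncation to the unit interval stops the
    segments at their ends. *)
Let clamp (t : R) : R := Num.max 0 (Num.min 1 t).

Let clamp01 t : 0 <= clamp t <= 1.
Proof. by rewrite /clamp le_max lexx /= ge_max ler01 ge_min lexx. Qed.

Let segment (e : R * R) (z : (R * R) * R) : R * R :=
  (e.1 + clamp z.2 * (z.1.1 - e.1), e.2 + clamp z.2 * (z.1.2 - e.2)).

Let continuous_segment e : continuous (segment e).
Proof.
move=> z.
have cc : {for z, continuous (fun z : (R * R) * R => clamp z.2)}.
  apply: continuous_comp; first exact: cvg_snd.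
  by apply: continuous_max; [exact: cvg_cst | apply: continuous_min; [exact: cvg_cst | exact: cvg_id]].
have c1 : {for z, continuous (fun z : (R * R) * R => z.1.1)}.
  by apply: continuous_comp; exact: cvg_fst.
have c2 : {for z, continuous (fun z : (R * R) * R => z.1.2)}.
  by apply: continuous_comp; [exact: cvg_fst | exact: cvg_snd].
have h1 : {for z, continuous (fun z : (R * R) * R => e.1 + clamp z.2 * (z.1.1 - e.1))}.
  apply: cvgD; first exact: cvg_cst.
  by apply: cvgM => //; apply: cvgB => //; exact: cvg_cst.
have h2 : {for z, continuous (fun z : (R * R) * R => e.2 + clamp z.2 * (z.1.2 - e.2))}.
  apply: cvgD; first exact: cvg_cst.
  by apply: cvgM => //; apply: cvgB => //; exact: cvg_cst.
exact: (cvg_pair h1 h2).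
Qed.

(** Convexity made explicit: the squared norm at a point of a segment is the interpolation of those
    at the ends minus a nonnegative multiple of the squared length. *)
Let segment_in_disc (e : R * R) z : e.1 ^+ 2 + e.2 ^+ 2 < 1 ->
  z.1.1 ^+ 2 + z.1.2 ^+ 2 < 1 -> (segment e z).1 ^+ 2 + (segment e z).2 ^+ 2 < 1.
Proof.
case: z e => [[x y] t] [a b] /= h1 h2; have /andP[c0 c1] := clamp01 t.
rewrite /segment /=; set c := clamp t in c0 c1 *.
have -> : (a + c * (x - a)) ^+ 2 + (b + c * (y - b)) ^+ 2 =
  c * (x ^+ 2 + y ^+ 2) + (1 - c) * (a ^+ 2 + b ^+ 2)
  - c * (1 - c) * ((x - a) ^+ 2 + (y - b) ^+ 2) by ring.
have h3 : 0 <= c * (1 - c) * ((x - a) ^+ 2 + (y - b) ^+ 2).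
  by apply: mulr_ge0; [apply: mulr_ge0; rewrite ?subr_ge0 | apply: addr_ge0; exact: sqr_ge0].
have h4 : 0 < c * (1 - (x ^+ 2 + y ^+ 2)) + (1 - c) * (1 - (a ^+ 2 + b ^+ 2)).
  (* When [c = 0], strictness comes from the other end [(a, b)]. *)
  have [c_gt0|c_le0] := ltP 0 c.
    by apply: ltr_wpDr; [apply: mulr_ge0; lra | apply: mulr_gt0; lra].
  have -> : c = 0 by apply/le_anti; rewrite c_le0.
  by rewrite mul0r add0r subr0 mul1r subr_gt0.
lra.
Qed.

Let sqdist_segment e z : sqdist (segment e z) e <= sqdist z.1 e.
Proof.
case: z e => [[x y] t] [a b]; have /andP[c0 c1] := clamp01 t.
rewrite /sqdist /segment /=; set c := clamp t in c0 c1 *.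
have -> : (a + c * (x - a) - a) ^+ 2 + (b + c * (y - b) - b) ^+ 2 =
  c ^+ 2 * ((x - a) ^+ 2 + (y - b) ^+ 2) by ring.
by rewrite ler_piMl ?addr_ge0 ?sqr_ge0// expr_le1.
Qed.

Let segment0 e z : z.2 <= 0 -> segment e z = e.
Proof.
case: e => a b z0; rewrite /segment /=.
have -> : clamp z.2 = 0 by rewrite /clamp max_l// ge_min z0 orbT.
by rewrite !mul0r !addr0.
Qed.

Let segment1 e y : segment e (y, 1) = y.
Proof.
case: e y => a b [c d]; rewrite /segment /=.
have -> : clamp 1 = 1 by rewrite /clamp minxx max_r.
by rewrite !mul1r !subrKC.
Qed.

Let segmentxx e t : segment e (e, t) = e.
Proof. by case: e => a b; rewrite /segment /= !subrr !mulr0 !addr0. Qed.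

Definition disc_contraction (e : disc R) (z : disc R * R) : disc R :=
  disc_of_coord (segment (disc_coord e) (disc_coord z.1, z.2)).

Lemma disc_contractionP e : contraction e (disc_contraction e).
Proof.
split.
- move=> z; apply: continuous_comp; last first.
    apply: continuous_disc_of_coord; apply: segment_in_disc; exact: disc_coord_lt1.
  apply: (@continuous_comp _ _ _ (fun z : disc R * R => (disc_coord z.1, z.2))); last first.
    exact: continuous_segment.
  have h1 : {for z, continuous (fun z : disc R * R => disc_coord z.1)}.
    by apply: continuous_comp; [exact: cvg_fst | exact: continuous_disc_coord].
  have h2 : {for z, continuous (fun z : disc R * R => z.2)} by exact: cvg_snd.
  exact: (cvg_pair h1 h2).
- by move=> y t t0; rewrite /disc_contraction segment0// disc_coordK.
- by move=> y; rewrite /disc_contraction segment1 disc_coordK.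
- by move=> t; rewrite /disc_contraction segmentxx disc_coordK.
Qed.

(** The ball is closed so that it also serves for compactness, and it is kept inside the unit disc,
    where [disc_of_coord] is a true inverse. *)
Let nbhs_sqdist (x : disc R) (N : set (disc R)) : nbhs x N -> exists2 e : R, 0 < e &
  forall t, sqdist t (disc_coord x) <= e ^+ 2 ->
    t.1 ^+ 2 + t.2 ^+ 2 < 1 /\ N (disc_of_coord t).
Proof.
move=> xN; have xlt := disc_coord_lt1 x; have := disc_coordK x.
move: (disc_coord x) xlt => c clt cx.
have : \forall t \near c, t.1 ^+ 2 + t.2 ^+ 2 < 1 /\ N (disc_of_coord t).
  apply: filterI; first exact: (open_nbhs_nbhs (conj open_unit_disc clt)).
  by apply: continuous_disc_of_coord; rewrite // cx.
(* Half the radius makes the closed Euclidean ball fit into the open ball of the product norm. *)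
move=> /nbhs_ballP[e /= e0 eN]; exists (e / 2); first by rewrite divr_gt0.
move=> t; rewrite /sqdist => te; apply: eN.
have e2 : (e / 2) ^+ 2 < e ^+ 2 by have := mulr_gt0 e0 e0; rewrite !expr2; lra.
have s1 := sqr_ge0 (t.1 - c.1); have s2 := sqr_ge0 (t.2 - c.2).
have lte (a : R) : a ^+ 2 < e ^+ 2 -> `|a| < e.
  by move=> ae; rewrite -(@ltr_pXn2r _ 2) ?nnegrE ?(ltW e0)// real_normK// num_real.
by split; rewrite -ball_normE /= distrC; apply: lte; lra.
Qed.

(** Euclidean balls are stable under the contraction to their centre, because segments do not
    increase the distance to it. *)
Lemma disc_locally_connected (x : disc R) N : nbhs x N ->
  exists A, [/\ nbhs x A, A `<=` N & connected A].
Proof.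
move=> /nbhs_sqdist[e e0 eN].
exists [set y | sqdist (disc_coord y) (disc_coord x) < e ^+ 2]; split.
- apply: open_nbhs_nbhs; split; last by rewrite /= /sqdist !subrr expr0n addr0 exprn_gt0.
  exact: open_sqball.
- by move=> y /ltW /eN[_]; rewrite disc_coordK.
- apply: (contraction_star_connected x (disc_contraction x) _ (disc_contractionP x)).
    by rewrite /= /sqdist !subrr expr0n addr0 exprn_gt0.
  move=> y t /=; rewrite /disc_contraction disc_of_coordK.
    exact/le_lt_trans/sqdist_segment.
  by apply: segment_in_disc; exact: disc_coord_lt1.
Qed.

(** Closed Euclidean balls within the unit disc are compact in the plane, and [disc_of_coord]
    carries them to compact sets of the disc. *)
Lemma disc_locally_compact (x : disc R) N : nbhs x N ->
  exists A, [/\ open A, A x, A `<=` N & compact (closure A)].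
Proof.
move=> /nbhs_sqdist[e e0 eN].
pose K : set (R * R) := [set t | sqdist t (disc_coord x) <= e ^+ 2].
have clK : closed K.
  apply: (@closed_comp _ _ (sqdist^~ (disc_coord x)) [set r | r <= e ^+ 2]); last exact: closed_le.
  by move=> t _; exact: continuous_sqdist.
have cK : compact K.
  apply: (@subclosed_compact _ K (`[(disc_coord x).1 - e, (disc_coord x).1 + e] `*`
    `[(disc_coord x).2 - e, (disc_coord x).2 + e])) => //.
    by apply: compact_setX; exact: segment_compact.
  move: (disc_coord x) @K clK => c K clK t; rewrite /K /= /sqdist => te.
  have s1 := sqr_ge0 (t.1 - c.1); have s2 := sqr_ge0 (t.2 - c.2).
  have lee (a : R) : a ^+ 2 <= e ^+ 2 -> `|a| <= e.
    by move=> ae; rewrite -(@ler_pXn2r _ 2) ?nnegrE ?(ltW e0)// real_normK// num_real.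
  have := lee (t.1 - c.1) ltac:(lra).
  have := lee (t.2 - c.2) ltac:(lra).
  by rewrite !ler_norml !in_itv /= => /andP[? ?] /andP[? ?]; split; apply/andP; split; lra.
pose A : set (disc R) := [set y | sqdist (disc_coord y) (disc_coord x) < e ^+ 2].
have cA : closure A `<=` [set y | K (disc_coord y)].
  have clK' : closed (disc_coord @^-1` K).
    by apply: closed_comp => // y _; exact: continuous_disc_coord.
  apply: (subset_trans (closureS (_ : A `<=` disc_coord @^-1` K))) => // y.
  exact: ltW.
exists A; split.
- exact: open_sqball.
- by rewrite /A /= /sqdist !subrr expr0n addr0 exprn_gt0.
- by move=> y /ltW /eN[_]; rewrite disc_coordK.
- apply: (@subclosed_compact _ _ (disc_of_coord @` K)); first exact: closed_closure.
    apply: continuous_compact => //; apply: continuous_in_subspaceT => t.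
    by rewrite inE => /eN[tD _]; exact: continuous_disc_of_coord.
  by move=> y /cA Ky; exists (disc_coord y) => //; rewrite disc_coordK.
Qed.

End disc_topology.

(** * Entrywise continuity of matrices *)

Section matrix_continuity.
Context {T : topologicalType} {m n : nat}.

Lemma continuous_mx_entry (i : 'I_m) (j : 'I_n) :
  continuous (fun M : 'M[T]_(m, n) => M i j).
Proof.
move=> M N MN; exists (fun i' j' => if (i' == i) && (j' == j) then N else setT).
  move=> i' j'; case: ifP => [/andP[/eqP-> /eqP->]//|_]; exact: filterT.
by move=> M' /(_ i j); rewrite !eqxx.
Qed.

Lemma continuous_into_mx {S : topologicalType} (f : S -> 'M[T]_(m, n)) x :
  (forall i j, {for x, continuous (fun y => f y i j)}) -> {for x, continuous f}.
Proof.
move=> cf N [P xP PN].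
have : \forall y \near x, forall i j, P i j (f y i j).
  apply: filter_forall => i; apply: filter_forall => j.
  exact: (cf i j _ (xP i j)).
by apply: filterS => y; exact: PN.
Qed.

End matrix_continuity.

(** * The projective plane, the closed ball and affine coordinates *)

Section projective_plane.
Context {R : realType}.
Local Notation C := (Cplx R).
Local Notation o0 := (inord 0 : 'I_3).
Local Notation o1 := (inord 1 : 'I_3).
Local Notation o2 := (inord 2 : 'I_3).

Lemma ord3P (i : 'I_3) : [\/ i = o0, i = o1 | i = o2].
Proof.
case: i => [[|[|[|//]]]] h; [constructor 1|constructor 2|constructor 3];
  by apply/val_inj; rewrite /= inordK.
Qed.

Lemma open_neq0 : open [set z : C | z != 0].
Proof.
have -> : [set z : C | z != 0] = (@R2_of_C R) @^-1` (~` [set (0, 0)]).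
  apply/seteqP; split=> -[a b] /=.
    by move=> /eqP h [a0 b0]; apply: h; rewrite a0 b0.
  by move=> h; apply/eqP => -[a0 b0]; apply: h; rewrite /R2_of_C /= a0 b0.
apply: open_comp; first by move=> z _; exact: continuous_R2_of_C.
apply: closed_openC; apply: compact_closed; first exact: (@norm_hausdorff _ (R * R)%type).
exact: compact_set1.
Qed.

Lemma open_nonzero_vector : open [set v : 'cV[C]_3 | v != 0].
Proof.
rewrite openE => v /= v0.
have [i vi0] : exists i, v i 0 != 0.
  apply: contrapT => h; move/eqP: v0; apply; apply/matrixP => i j; rewrite ord1 mxE.
  by apply/eqP; apply: contrapT => vi; apply: h; exists i; apply/negP.
have : nbhs v ((fun w : 'cV[C]_3 => w i 0) @^-1` [set z | z != 0]).
  by apply: (continuous_mx_entry i 0); apply: open_nbhs_nbhs; split => //; exact: open_neq0.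
by apply: filterS => w /=; apply: contraNneq => ->; rewrite mxE.
Qed.

Lemma insubd_nonzero (v : 'cV[C]_3) : v != 0 -> val (insubd (e3 R) v) = v.
Proof. by move=> v0; apply: insubdK; rewrite inE. Qed.

Lemma cproj_eqP (v w : 'cV[C]_3) : v != 0 -> w != 0 ->
  cproj v = cproj w <-> exists2 k : C, k != 0 & v = k *: w.
Proof.
move=> v0 w0; split.
  move=> /eqP; rewrite /cproj => /eqP/eqquotP/asboolP[k [k0]].
  by rewrite !insubd_nonzero// => ->; exists k.
move=> [k k0 vw]; apply/eqquotP/asboolP; exists k.
by rewrite !insubd_nonzero.
Qed.

Lemma hom_coord_neq0 (x : CP2 R) : hom_coord x != 0.
Proof. by have := valP (repr x : nonzero R); rewrite inE. Qed.

Lemma hom_coordK (x : CP2 R) : cproj (hom_coord x) = x.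
Proof. by rewrite /cproj /hom_coord valKd reprK. Qed.

Lemma hom_coord_cproj (v : 'cV[C]_3) : v != 0 ->
  exists2 k : C, k != 0 & hom_coord (cproj v) = k *: v.
Proof.
by move=> v0; apply/cproj_eqP => //; rewrite ?hom_coordK// hom_coord_neq0.
Qed.

Lemma continuous_cproj (v : 'cV[C]_3) : v != 0 -> {for v, continuous (@cproj R)}.
Proof.
move=> v0; apply: continuous_comp; last exact: pi_continuous.
apply: continuous_into_set_type; apply: (near_eq_continuous id); last exact: cvg_id.
have := open_nbhs_nbhs (conj open_nonzero_vector v0).
by apply: filterS => w /= w0; rewrite insubd_nonzero.
Qed.

Lemma open_CP2 (A : set (CP2 R)) :
  open [set v : nonzero R | A (cproj (val v))] -> open A.
Proof.
have -> : [set v : nonzero R | A (cproj (val v))] = (\pi_(CP2 R))%qT @^-1` A => //.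
by apply/seteqP; split => v /=; rewrite /cproj valKd.
Qed.

(** The quotient topology reduces the claim to openness of a preimage among nonzero vectors.
    Restricting to [U] accommodates [affine_coord], which divides by the third coordinate. *)
Lemma continuous_from_CP2 {Z : topologicalType} (f : CP2 R -> Z) (U : set (CP2 R)) :
  open U -> (forall v : nonzero R, U (cproj (val v)) ->
    {for v, continuous (fun w : nonzero R => f (cproj (val w)))}) ->
  {in U, continuous f}.
Proof.
move=> oU cf x; rewrite inE => Ux N xN.
have : open (U `&` [set y | N° (f y)]).
  apply: open_CP2; rewrite openE => v [Uv Nv].
  have cpv : {for v, continuous (fun w : nonzero R => cproj (val w))}.
    apply: continuous_comp; first exact: continuous_val.
    by apply: continuous_cproj; have := valP v; rewrite inE.
  apply: filterI; first by apply: cpv; exact: open_nbhs_nbhs.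
  by apply: (cf v Uv); apply: open_nbhs_nbhs; split => //; exact: open_interior.
move=> oA; apply: (@filterS _ (nbhs x) _ (U `&` [set y | N° (f y)])).
  by move=> y [_] /interior_subset.
by apply: open_nbhs_nbhs; split.
Qed.

(** A real number, so that signs are compared in [R] rather than in the partial order of the complex
    numbers. *)
Definition qform (v : 'cV[C]_3) : R :=
  sqmod (v o0 0) + sqmod (v o1 0) - sqmod (v o2 0).

Lemma hermE v : herm v v = ((qform v)%:C)%C.
Proof.
rewrite /herm /qform /sqmod; case: (v o0 0) (v o1 0) (v o2 0) => [a b] [c d] [e f].
by apply/eqP; rewrite eq_complex /=; apply/andP; split; apply/eqP; ring.
Qed.

Lemma sqmodM (z w : C) : sqmod (z * w) = sqmod z * sqmod w.
Proof. by rewrite /sqmod; case: z w => [a b] [c d] /=; ring. Qed.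

Lemma sqmod_ge0 (z : C) : 0 <= sqmod z.
Proof. by rewrite /sqmod addr_ge0 ?sqr_ge0. Qed.

Lemma sqmod_eq0 (z : C) : (sqmod z == 0) = (z == 0).
Proof.
case: z => a b; rewrite /sqmod /= paddr_eq0 ?sqr_ge0// !sqrf_eq0.
by rewrite eq_complex.
Qed.

Lemma qformZ k v : qform (k *: v) = sqmod k * qform v.
Proof. by rewrite /qform !mxE !sqmodM; ring. Qed.

Lemma continuous_sqmod : continuous (@sqmod R).
Proof.
move=> z; have cR := continuous_Re z; have cI := continuous_Im z.
exact: (cvgD (cvgM cR cR) (cvgM cI cI)).
Qed.

Lemma continuous_qform : continuous qform.
Proof.
move=> v.
have c i : {for v, continuous (fun w : 'cV[C]_3 => sqmod (w i 0))}.
  by apply: continuous_comp; [exact: continuous_mx_entry | exact: continuous_sqmod].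
exact: (cvgB (cvgD (c o0) (c o1)) (c o2)).
Qed.

(** On vectors with vanishing third coordinate the form is positive definite. Hence the closed ball
    avoids the line at infinity of the affine chart. *)
Lemma qform_le0_neq0 v : v != 0 -> qform v <= 0 -> v o2 0 != 0.
Proof.
move=> v0 qv; apply: contraNneq v0 => v20.
have s0 : sqmod (v o2 0) = 0 by apply/eqP; rewrite sqmod_eq0 v20.
have h0 := sqmod_ge0 (v o0 0); have h1 := sqmod_ge0 (v o1 0).
rewrite /qform s0 in qv.
have /eqP : sqmod (v o0 0) = 0 by lra.
have /eqP : sqmod (v o1 0) = 0 by lra.
rewrite !sqmod_eq0 => /eqP v1 /eqP v00.
by apply/eqP/matrixP => i j; rewrite ord1 mxE; case: (ord3P i) => ->.
Qed.

(** The closed ball. Every representative gives the same sign, since rescaling multiplies the form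
    by a positive factor. *)
Definition CH2bar : set (CP2 R) := [set x | qform (hom_coord x) <= 0].
Definition affine_chart : set (CP2 R) := [set x | hom_coord x o2 0 != 0].

Lemma CH2bar_cproj v : v != 0 -> CH2bar (cproj v) <-> qform v <= 0.
Proof.
move=> v0; rewrite /CH2bar /=; have [k k0 ->] := hom_coord_cproj v v0.
by rewrite qformZ pmulr_rle0// lt0r sqmod_eq0 k0 sqmod_ge0.
Qed.

Lemma CH2_cproj v : v != 0 -> CH2 R (cproj v) <-> qform v < 0.
Proof.
move=> v0; have nz w : qform w < 0 -> w != 0.
  by apply: contraTneq => ->; rewrite /qform !mxE /sqmod /= !expr0n/= !addr0 subr0 ltxx.
split=> [[w]|qv]; last by exists v => //; rewrite /Wminus /= hermE ltcR.
rewrite /Wminus /= hermE ltcR => qw /esym /(cproj_eqP v w v0 (nz _ qw))[k k0 ->].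
by rewrite qformZ pmulr_rlt0// lt0r sqmod_eq0 k0 sqmod_ge0.
Qed.

Lemma affine_chart_cproj v : v != 0 -> affine_chart (cproj v) <-> v o2 0 != 0.
Proof.
move=> v0; rewrite /affine_chart /=; have [k k0 ->] := hom_coord_cproj v v0.
by rewrite mxE mulf_eq0 negb_or k0.
Qed.

Lemma affine_coord_cproj v : v != 0 -> affine_coord (cproj v) =
  (@R2_of_C R (v o0 0 / v o2 0), @R2_of_C R (v o1 0 / v o2 0)).
Proof.
move=> v0; rewrite /affine_coord; have [k k0 ->] := hom_coord_cproj v v0.
have kK (a b : C) : k * a / (k * b) = a / b by rewrite invfM mulrACA mulfV// mul1r.
by rewrite !mxE !kK.
Qed.

Lemma val_nonzero (v : nonzero R) : val v != 0.
Proof. by have := valP v; rewrite inE. Qed.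

Let continuous_nonzero_entry i : continuous (fun v : nonzero R => val v i 0).
Proof.
move=> v; apply: (@continuous_comp _ _ _ (val : nonzero R -> 'cV[C]_3)
  (fun M => M i 0)); first exact: continuous_val.
exact: continuous_mx_entry.
Qed.

Let continuous_nonzero_qform : continuous (fun v : nonzero R => qform (val v)).
Proof.
move=> v; apply: (@continuous_comp _ _ _ (val : nonzero R -> 'cV[C]_3)); last first.
  exact: continuous_qform.
exact: continuous_val.
Qed.

Lemma open_affine_chart : open affine_chart.
Proof.
apply: open_CP2.
have -> : [set v : nonzero R | affine_chart (cproj (val v))] =
    (fun v : nonzero R => val v o2 0) @^-1` [set z | z != 0].
  by apply/seteqP; split=> v /=; move/(affine_chart_cproj _ (val_nonzero v)).
by apply: open_comp; [move=> v _; exact: continuous_nonzero_entry | exact: open_neq0].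
Qed.

Lemma open_CH2 : open (CH2 R).
Proof.
apply: open_CP2.
have -> : [set v : nonzero R | CH2 R (cproj (val v))] =
    (fun v : nonzero R => qform (val v)) @^-1` [set x | x < 0].
  by apply/seteqP; split=> v /=; move/(CH2_cproj _ (val_nonzero v)).
by apply: open_comp; [move=> v _; exact: continuous_nonzero_qform | exact: open_lt].
Qed.

Lemma closed_CH2bar : closed CH2bar.
Proof.
rewrite -openC; apply: open_CP2.
have -> : [set v : nonzero R | (~` CH2bar) (cproj (val v))] =
    (fun v : nonzero R => qform (val v)) @^-1` [set x | 0 < x].
  apply/seteqP; split=> v /= h.
    by rewrite ltNge; apply/negP => /(CH2bar_cproj _ (val_nonzero v)).
  by move=> /(CH2bar_cproj _ (val_nonzero v)); rewrite leNgt h.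
by apply: open_comp; [move=> v _; exact: continuous_nonzero_qform | exact: open_gt].
Qed.

Lemma CH2bar_affine_chart : CH2bar `<=` affine_chart.
Proof. by move=> x; apply: qform_le0_neq0; exact: hom_coord_neq0. Qed.

Lemma CH2_CH2bar : CH2 R `<=` CH2bar.
Proof.
move=> x; rewrite -[x]hom_coordK => /(CH2_cproj _ (hom_coord_neq0 x)) /ltW.
by move/(CH2bar_cproj _ (hom_coord_neq0 x)).
Qed.

Lemma continuous_affine_coord : {in affine_chart, continuous (@affine_coord R)}.
Proof.
apply: continuous_from_CP2; first exact: open_affine_chart.
move=> v /(affine_chart_cproj _ (val_nonzero v)) v2.
pose f (w : nonzero R) := (@R2_of_C R (val w o0 0 / val w o2 0), @R2_of_C R (val w o1 0 / val w o2 0)).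
rewrite (_ : (fun w => _) = f); last first.
  by apply/funext => w; rewrite affine_coord_cproj//; exact: val_nonzero.
have h i : {for v, continuous (fun w : nonzero R => @R2_of_C R (val w i 0 / val w o2 0))}.
  have c0 := continuous_nonzero_entry i v; have c2 := continuous_nonzero_entry o2 v.
  apply: (@continuous_comp _ _ _ (fun w : nonzero R => val w i 0 / val w o2 0 : C)).
    exact: (cvgM c0 (cvgV v2 c2)).
  exact: continuous_R2_of_C.
exact: (cvg_pair (h o0) (h o1)).
Qed.

Lemma affine_coord_inj : {in affine_chart &, injective (@affine_coord R)}.
Proof.
move=> x y; rewrite !inE /affine_chart /= => x2 y2.
have R2inj (z w : C) : R2_of_C z = R2_of_C w -> z = w.
  by move=> h; rewrite -[z]C_of_R2K h C_of_R2K.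
move=> /pair_equal_spec[/R2inj h0 /R2inj h1].
rewrite -[x]hom_coordK -[y]hom_coordK.
apply/cproj_eqP; rewrite ?hom_coord_neq0//.
(* The scalar is forced by comparing third coordinates. *)
exists (hom_coord x o2 0 / hom_coord y o2 0); first by rewrite mulf_neq0 ?invr_eq0.
apply/matrixP => i j; rewrite ord1 mxE mulrAC -mulrA.
case: (ord3P i) => ->.
- by rewrite -h0 mulrCA mulfV// mulr1.
- by rewrite -h1 mulrCA mulfV// mulr1.
- by rewrite mulfV// mulr1.
Qed.

Lemma mulmx_det1_neq0 (M : 'M[C]_3) (v : 'cV[C]_3) : \det M = 1 -> v != 0 -> M *m v != 0.
Proof.
move=> dM; apply: contraNneq => Mv0.
have uM : M \in unitmx by rewrite unitmxE dM unitr1.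
by rewrite -[v](mulKmx uM) Mv0 mulmx0.
Qed.

Lemma CP2_act_cproj (M : 'M[C]_3) (v : 'cV[C]_3) : \det M = 1 -> v != 0 ->
  CP2_act M (cproj v) = cproj (M *m v).
Proof.
move=> dM v0; rewrite /CP2_act; have [k k0 ->] := hom_coord_cproj v v0.
apply/cproj_eqP; [|exact: mulmx_det1_neq0|by exists k => //; rewrite scalemxAr].
by apply: mulmx_det1_neq0 => //; rewrite scalemx_eq0 negb_or k0.
Qed.

End projective_plane.

(** * The normal exponential map: continuity and inverse *)

Section normal_exponential_map.
Context {R : realType}.
Local Notation C := (Cplx R).
Local Notation o0 := (inord 0 : 'I_3).
Local Notation o1 := (inord 1 : 'I_3).
Local Notation o2 := (inord 2 : 'I_3).

(* The entries are ia - b, ia + b and 1, for t = (a, b). *)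
Definition normal_vec (t : R * R) : 'cV[C]_3 :=
  \col_i nth 0 [:: C_of_R2 (- t.2, t.1); C_of_R2 (t.2, t.1); 1] i.

Lemma normal_vec0 t : normal_vec t o0 0 = C_of_R2 (- t.2, t.1).
Proof. by rewrite mxE inordK. Qed.
Lemma normal_vec1 t : normal_vec t o1 0 = C_of_R2 (t.2, t.1).
Proof. by rewrite mxE inordK. Qed.
Lemma normal_vec2 t : normal_vec t o2 0 = 1.
Proof. by rewrite mxE inordK. Qed.

Lemma normal_vec_neq0 t : normal_vec t != 0.
Proof.
apply/eqP => /matrixP /(_ o2 0) /eqP.
by rewrite normal_vec2 mxE oner_eq0.
Qed.

(** This explains the bound [2^-1] in [normal_disc]: the form is negative on normal vectors exactly
    inside that disc, and zero on its boundary circle. *)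
Lemma qform_normal_vec t : qform (normal_vec t) = 2 * (t.1 ^+ 2 + t.2 ^+ 2) - 1.
Proof.
by rewrite /qform normal_vec0 normal_vec1 normal_vec2 /sqmod /=; ring.
Qed.

(** With the frame as a left factor, [rho g] acts on one side and the rotation of the normal
    coordinate on the other. *)
Lemma normal_expE (F : disc R -> 'M[C]_3) z t :
  normal_exp F z t = cproj (F z *m normal_vec t).
Proof.
rewrite /normal_exp; congr cproj; rewrite !colE.
rewrite !scalemxAr -!mulmxDr; congr (_ *m _).
have n01 : (o0 == o1) = false by apply/eqP => /(congr1 val); rewrite /= !inordK.
have n02 : (o0 == o2) = false by apply/eqP => /(congr1 val); rewrite /= !inordK.
have n12 : (o1 == o2) = false by apply/eqP => /(congr1 val); rewrite /= !inordK.
apply/matrixP => i j; rewrite ord1 {j}; case: (ord3P i) => ->;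
  rewrite ?normal_vec0 ?normal_vec1 ?normal_vec2 !mxE !eqxx
    ?n01 ?n02 ?n12 1?eq_sym ?n01 ?n02 ?n12 1?[_ == o2]eq_sym ?n01 ?n02 ?n12 /=
    ?mulr0 ?mulr1 ?addr0 ?add0r //.
- by apply/eqP; rewrite eq_complex /=; apply/andP; split; apply/eqP; ring.
- by apply/eqP; rewrite eq_complex /=; apply/andP; split; apply/eqP; ring.
- by rewrite (eq_sym o2) n12 mulr0 add0r.
Qed.

Lemma qform_SU21 (M : 'M[C]_3) v : SU21 M -> qform (M *m v) = qform v.
Proof.
move=> [/(_ v v) + _]; rewrite !hermE => /eqP; rewrite eq_complex /= => /andP[/eqP].
by [].
Qed.

Lemma SU21_det (M : 'M[C]_3) : SU21 M -> \det M = 1.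
Proof. by case. Qed.

Variable F : disc R -> 'M[C]_3.
Hypothesis SUF : forall z, SU21 (F z).

Lemma frame_normal_vec_neq0 z t : F z *m normal_vec t != 0.
Proof. by apply: mulmx_det1_neq0; [exact: SU21_det | exact: normal_vec_neq0]. Qed.

Lemma normal_exp_CH2bar z t : normal_cdisc t -> CH2bar (normal_exp F z t).
Proof.
rewrite normal_expE /normal_cdisc /= => tD.
apply/CH2bar_cproj; first exact: frame_normal_vec_neq0.
by rewrite qform_SU21// qform_normal_vec; lra.
Qed.

Lemma normal_exp_CH2 z t : normal_disc t -> CH2 R (normal_exp F z t).
Proof.
rewrite normal_expE /normal_disc /= => tD.
apply/CH2_cproj; first exact: frame_normal_vec_neq0.
by rewrite qform_SU21// qform_normal_vec; lra.
Qed.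

Hypothesis smF : forall i j, smoothCC disc_set (fun w => F (of_C w) i j).

Lemma continuous_frame_entry i j : continuous (fun z => F z i j).
Proof.
(* Smoothness of order 0 is continuity of the real and imaginary parts. *)
have [smR smI] := smF i j; have [cR _] := smR 0; have [cI _] := smI 0.
move=> z; have zD : disc_coord z \in (@C_of_R2 R) @^-1` disc_set.
  by rewrite inE /= C_of_R2K; exact: disc_val.
pose f (z : disc R) : C := C_of_R2 (complex.Re (F (of_C (C_of_R2 (disc_coord z))) i j),
  complex.Im (F (of_C (C_of_R2 (disc_coord z))) i j)).
rewrite (_ : (fun z => F z i j) = f); last first.
  apply/funext => w; rewrite /f -/(disc_of_coord (disc_coord w)) disc_coordK.
  by rewrite -[LHS]C_of_R2K.
have h1 := continuous_comp (continuous_disc_coord z) (cR _ zD).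
have h2 := continuous_comp (continuous_disc_coord z) (cI _ zD).
apply: continuous_comp; last exact: continuous_C_of_R2.
exact: (cvg_pair h1 h2).
Qed.

Lemma continuous_normal_vec i : continuous (fun t => normal_vec t i 0).
Proof.
move=> t; have c1 : {for t, continuous (fun t : R * R => t.1)} by exact: cvg_fst.
have c2 : {for t, continuous (fun t : R * R => t.2)} by exact: cvg_snd.
case: (ord3P i) => ->.
- rewrite (_ : (fun _ => _) = (@C_of_R2 R \o (fun t => (- t.2, t.1)))).
    apply: continuous_comp; last exact: continuous_C_of_R2.
    exact: (cvg_pair (cvgN c2) c1).
  by apply/funext => s; rewrite normal_vec0.
- rewrite (_ : (fun _ => _) = (@C_of_R2 R \o (fun t => (t.2, t.1)))).
    apply: continuous_comp; last exact: continuous_C_of_R2.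
    exact: (cvg_pair c2 c1).
  by apply/funext => s; rewrite normal_vec1.
- rewrite (_ : (fun _ => _) = (fun=> 1)); first exact: cvg_cst.
  by apply/funext => s; rewrite normal_vec2.
Qed.

Lemma continuous_normal_exp : continuous (fun y : disc R * (R * R) => normal_exp F y.1 y.2).
Proof.
move=> y; rewrite (_ : (fun _ => _) =
  (@cproj R \o (fun y : disc R * (R * R) => F y.1 *m normal_vec y.2))); last first.
  by apply/funext => ?; rewrite normal_expE.
apply: continuous_comp; last first.
  by apply: continuous_cproj; exact: frame_normal_vec_neq0.
apply: continuous_into_mx => i j; rewrite ord1 {j}.
have c k : {for y, continuous (fun y : disc R * (R * R) => F y.1 i k * normal_vec y.2 k 0 : C)}.
  have c1 : {for y, continuous (fun y : disc R * (R * R) => F y.1 i k)}.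
    by apply: (@continuous_comp _ _ _ fst (fun z => F z i k));
      [exact: cvg_fst | exact: continuous_frame_entry].
  have c2 : {for y, continuous (fun y : disc R * (R * R) => normal_vec y.2 k 0)}.
    by apply: (@continuous_comp _ _ _ snd (fun t => normal_vec t k 0));
      [exact: cvg_snd | exact: continuous_normal_vec].
  exact: (cvgM c1 c2).
pose f k (y : disc R * (R * R)) : C := F y.1 i k * normal_vec y.2 k 0.
pose k1 : 'I_3 := lift ord0 ord0; pose k2 : 'I_3 := lift ord0 (lift ord0 ord0).
rewrite (_ : (fun _ => _) = (fun y => f k2 y + (f k1 y + f ord0 y))).
  exact: (cvgD (c _) (cvgD (c _) (c _))).
by apply/funext => w; rewrite mxE !big_ord_recl big_ord0 addr0 /f; ring.
Qed.

(** The inverse of the diffeomorphism lives in affine coordinates. Composed with [affine_coord] it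
    becomes a continuous section over the ball, where affine coordinates separate points. *)
Lemma normal_exp_inverse : normal_exp_diffeo F -> exists G : CP2 R -> disc R * (R * R),
  {in CH2 R, continuous G} /\
  forall x, CH2 R x -> normal_disc (G x).2 /\ normal_exp F (G x).1 (G x).2 = x.
Proof.
move=> [PhiCH2 [_ _ [g [smg gBA _ gf]]]]; have [cg _] := smg 0.
exists (fun x => (disc_of_coord (g (affine_coord x)).1, (g (affine_coord x)).2)).
have chart x : CH2 R x -> affine_chart x.
  by move=> /CH2_CH2bar /CH2bar_affine_chart.
have gA x : CH2 R x -> (g (affine_coord x)).1.1 ^+ 2 + (g (affine_coord x)).1.2 ^+ 2 < 1
    /\ normal_disc (g (affine_coord x)).2.
  move=> xCH; have [] := gBA (affine_coord x) (ex_intro2 _ _ x xCH erefl).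
  by move=> /disc_set_C_of_R2.
split=> [x|x xCH].
- rewrite inE => xCH; have [gx1 gx2] := gA x xCH.
  have cga : {for x, continuous (g \o @affine_coord R)}.
    apply: continuous_comp; first by apply: continuous_affine_coord; rewrite inE; exact: chart.
    by apply: cg; rewrite inE; exists x.
  have c1 : {for x, continuous (fun x => disc_of_coord (g (affine_coord x)).1)}.
    apply: (@continuous_comp _ _ _ (fun x => (g (affine_coord x)).1)); last first.
      exact: continuous_disc_of_coord.
    exact: continuous_comp_fst cga.
  have c2 : {for x, continuous (fun x => (g (affine_coord x)).2)}.
    exact: continuous_comp_snd cga.
  exact: (cvg_pair c1 c2).
- have [gx1 gx2] := gA x xCH; split => //=.
  apply: affine_coord_inj; rewrite ?inE; [|exact: chart|].
    exact/chart/PhiCH2.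
  by apply: gf; rewrite inE; exists x.
Qed.

End normal_exponential_map.

(** * Tubes of normal discs over subsets of the disc *)

Section normal_tubes.
Context {R : realType} (F : disc R -> 'M[Cplx R]_3).
Hypotheses (SUF : forall z, SU21 (F z))
  (smF : forall i j, smoothCC disc_set (fun w => F (of_C w) i j))
  (dF : normal_exp_diffeo F) (iF : normal_exp_closed_injective F).

(** Over a transversal of the covering this is the fundamental domain. *)
Definition normal_tube (D : set (disc R)) : set (CP2 R) :=
  [set x | exists z t, [/\ D z, normal_disc t & normal_exp F z t = x]].

Lemma normal_disc_cdisc (t : R * R) : normal_disc t -> normal_cdisc t.
Proof. exact: ltW. Qed.

Lemma normal_tube_CH2 D : normal_tube D `<=` CH2 R.
Proof. by move=> _ [z [t [_ tD <-]]]; exact: normal_exp_CH2. Qed.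

Lemma CH2_normal_exp x : CH2 R x -> exists z t, normal_disc t /\ normal_exp F z t = x.
Proof.
have [G [_ hG]] := normal_exp_inverse F dF.
by move=> /hG[tD xG]; exists (G x).1, (G x).2.
Qed.

(** Injectivity of the normal exponential map identifies the tube with the part of the ball where
    the base component of the continuous inverse lies in [D]. *)
Lemma open_normal_tube D : open D -> open (normal_tube D).
Proof.
move=> oD; have [G [cG hG]] := normal_exp_inverse F dF.
rewrite openE => x Dx; have xCH := normal_tube_CH2 D x Dx.
have GD : D (G x).1.
  have [tG xG] := hG x xCH; have [z [t [Dz tD zx]]] := Dx.
  by have [-> _] := iF _ _ _ _ (normal_disc_cdisc _ tG) (normal_disc_cdisc _ tD)
    (etrans xG (esym zx)).
have cG1 : {for x, continuous (fun y => (G y).1)}.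
  by apply: continuous_comp_fst; apply: cG; rewrite inE.
have nG : nbhs x [set y | D (G y).1] by apply: cG1; exact: open_nbhs_nbhs.
have nCH : nbhs x (CH2 R) by apply: open_nbhs_nbhs; split => //; exact: open_CH2.
apply: filterS (filterI nG nCH) => y [/= DGy /hG[tG yG]].
by exists (G y).1, (G y).2.
Qed.

Lemma compact_normal_cdisc : compact (@normal_cdisc R).
Proof.
apply: (@subclosed_compact _ (@normal_cdisc R) (`[(-1 : R), 1] `*` `[(-1 : R), 1])).
- apply: (@closed_comp _ _ (fun t : R * R => t.1 ^+ 2 + t.2 ^+ 2) [set x | x <= 2^-1]); last exact: closed_le.
  move=> t _.
  have c1 : {for t, continuous (fun t : R * R => t.1)} by exact: cvg_fst.
  have c2 : {for t, continuous (fun t : R * R => t.2)} by exact: cvg_snd.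
  exact: (cvgD (cvgM c1 c1) (cvgM c2 c2)).
- by apply: compact_setX; exact: segment_compact.
- move=> [a b]; rewrite /normal_cdisc /= !in_itv /= => ab.
  have s1 := sqr_ge0 a; have s2 := sqr_ge0 b.
  have le1 (c : R) : c ^+ 2 <= 1 -> -1 <= c <= 1.
    by rewrite -ler_norml -real_normK ?num_real// expr_le1.
  by split; apply: le1; lra.
Qed.

(** The closure stays in the closed ball, hence in the affine chart. In affine coordinates the image
    of the compact product of [closure D] and the closed normal disc is compact, so it is closed and
    contains every limit of the tube. *)
Lemma closure_normal_tube D : compact (closure D) -> closure (normal_tube D) `<=`
  [set x | exists z t, [/\ closure D z, normal_cdisc t & normal_exp F z t = x]].
Proof.
move=> cD x xD; set S := [set x | _].
pose Phi (y : disc R * (R * R)) := normal_exp F y.1 y.2.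
have SB : S `<=` @CH2bar R by move=> _ [z [t [_ tD <-]]]; exact: normal_exp_CH2bar.
have TS : normal_tube D `<=` S.
  move=> _ [z [t [Dz tD <-]]]; exists z, t.
  by split=> //; [exact: subset_closure | exact: normal_disc_cdisc].
have xB : CH2bar x.
  by apply: (closed_CH2bar x); apply: closureS xD; exact: subset_trans SB.
have cS : compact ((@affine_coord R \o Phi) @` (closure D `*` @normal_cdisc R)).
  apply: continuous_compact; last exact: (compact_setX cD compact_normal_cdisc).
  apply: continuous_in_subspaceT => -[z t]; rewrite inE => -[_ /= tD].
  apply: continuous_comp; first exact: continuous_normal_exp.
  apply: continuous_affine_coord; rewrite inE.
  by apply: CH2bar_affine_chart; exact: normal_exp_CH2bar.
have hR4 : hausdorff_space (((R * R) * (R * R))%type : topologicalType).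
  exact: (@norm_hausdorff _ ((R * R) * (R * R))%type).
have /(compact_closed hR4 cS)[[z t] [/= Dz tD] ztx] :
    closure ((@affine_coord R \o Phi) @` (closure D `*` @normal_cdisc R)) (affine_coord x).
  move=> N /(continuous_affine_coord x); rewrite inE => /(_ (CH2bar_affine_chart _ xB)).
  move=> /xD[y [/TS[z [t [Dz tD <-]]] Ny]].
  by exists (affine_coord (normal_exp F z t)); split => //; exists (z, t).
exists z, t; split => //; apply: affine_coord_inj => //; rewrite inE.
  by apply: CH2bar_affine_chart; exact: normal_exp_CH2bar.
exact: CH2bar_affine_chart.
Qed.

(** Only the base point has to be approximated; [t] stays fixed inside the open disc. *)
Lemma normal_exp_closure_tube D z t : closure D z -> normal_disc t ->
  closure (normal_tube D) (normal_exp F z t).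
Proof.
move=> Dz tD N zN.
have cN := continuous_pairl _ _ _ (continuous_normal_exp F SUF smF (z, t)) N zN.
have [w [Dw Nw]] := Dz _ cN.
by exists (normal_exp F w t); split => //; exists w, t.
Qed.

End normal_tubes.

(** * Equivariance of the normal exponential map *)

Section holonomy.
Context {R : realType} {X : riemannSurface R} (p : disc R -> X).
Local Notation C := (Cplx R).
Variables (F : disc R -> 'M[C]_3) (rho : (disc R -> disc R) -> 'M[C]_3).
Hypotheses (SUF : forall z, SU21 (F z)) (Hrho : is_holonomy p F rho).

(** The quotient defining the rotation is [0] when [g'] vanishes, so its modulus is not known to be
    1 in advance; the determinant records it. *)
Lemma det_frame_rot (g' : C) : \det (frame_rot g') = ((sqmod (g' / `|g'|))%:C)%C.
Proof.
rewrite det_trig; last first.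
  apply/is_trig_mxP => i j; rewrite mxE.
  by case: i j => [[|[|[|//]]] ?] [[|[|[|//]]] ?].
rewrite !big_ord_recl big_ord0 !mxE /= !mulr1.
move: (g' / _) => t; rewrite /sqmod; case: t => a b.
by apply/eqP; rewrite eq_complex /=; apply/andP; split; apply/eqP; ring.
Qed.

(** The factor [frame_rot] in the holonomy relation multiplies the normal coordinate by a unit
    complex number. Of the resulting rotation [r] only invariance of the norm and surjectivity are
    recorded. *)
Lemma holonomy_normal_exp g z : deck p g -> exists r : R * R -> R * R,
  [/\ forall t, (r t).1 ^+ 2 + (r t).2 ^+ 2 = t.1 ^+ 2 + t.2 ^+ 2,
    forall t, exists t', r t' = t &
    forall t, CP2_act (rho g) (normal_exp F z t) = normal_exp F (g z) (r t)].
Proof.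
move=> dg; have [SUrho _ /(_ g z dg) Fgz] := Hrho.
have dr := SU21_det _ (SUrho g dg).
(* All other factors of the holonomy relation have determinant 1, so frame_rot
   is invertible and gamma'/|gamma'| is a unit. *)
have : \det (invmx (frame_rot (disc_deriv g z))) = 1.
  have := SU21_det _ (SUF (g z)); rewrite Fgz !det_mulmx dr (SU21_det _ (SUF z)).
  by rewrite !mul1r.
rewrite det_inv => /(congr1 GRing.inv); rewrite invrK invr1 => drot.
have urot : frame_rot (disc_deriv g z) \in unitmx by rewrite unitmxE drot unitr1.
move: Fgz => /(congr1 (mulmx^~ (frame_rot (disc_deriv g z)))).
rewrite mulmxKV// => Frot; move: drot Frot; rewrite det_frame_rot /frame_rot.
move: (disc_deriv g z / _) => th; rewrite /sqmod.
case: th => c s /= /eqP; rewrite eq_complex /= => /andP[/eqP cs1 _] Frot.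
(* As ia - b = i(a + ib) and ia + b = i(a - ib), the diagonal entries [th], its conjugate and 1
   multiply a + ib by [th], that is, by c + is. *)
exists (fun t => (c * t.1 - s * t.2, c * t.2 + s * t.1)); split.
- move=> [a b] /=; rewrite -[RHS]mul1r -cs1; ring.
- move=> [a b]; exists (c * a + s * b, c * b - s * a) => /=.
  by congr pair; rewrite -[RHS]mul1r -cs1; ring.
- move=> t; rewrite (normal_expE F z) (normal_expE F (g z)).
  rewrite (CP2_act_cproj _ _ dr (frame_normal_vec_neq0 _ SUF z t)) mulmxA -Frot -mulmxA; congr (cproj (_ *m _)).
  apply/matrixP => i j; rewrite ord1 {j} mxE !big_ord_recl big_ord0 !mxE /=.
  case: (ord3P i) => ->; rewrite !inordK //=;
  by apply/eqP; rewrite eq_complex /=; apply/andP; split; apply/eqP; ring.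
Qed.

End holonomy.

(** * The tube over a transversal as fundamental domain *)

Theorem corollary7p3 (R : realType) (kappa : R) (Hkappa : good_bound kappa)
    (X : riemannSurface R) (h : chart R X -> Cplx R -> R)
    (q : chart R X -> Cplx R -> Cplx R) (u : X -> R) (p : disc R -> X)
    (F : disc R -> 'M[Cplx R]_3) (rho : (disc R -> disc R) -> 'M[Cplx R]_3)
    (Hsetting : surface_setting h q u p F)
    (Hrho : is_holonomy p F rho)
    (Hbound : forall x : X, Num.sqrt (sqnormU h q x) < kappa) :
  exists Fd : set (CP2 R),
    fundamental_domain (deck p) (fun g => CP2_act (rho g)) (CH2 R) Fd /\
    finite_set [set g | deck p g /\
      (CP2_act (rho g) @` closure Fd) `&` closure Fd !=set0].
Proof.
have [dF iF] : normal_exp_diffeo F /\ normal_exp_closed_injective F.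
  by case: Hkappa => _; apply; [exact: Hsetting | exact: Hbound].
have [cX _ _ _ [[cov _] [SUF smF _ _]]] := Hsetting.
have contr (e : disc R) : exists H : disc R * R -> disc R, contraction e H.
  by exists (disc_contraction e); exact: disc_contractionP.
have [D [[oD cD injD] pD]] := covering_transversal p cov (@surface_hausdorff _ X)
  disc_locally_compact cX.
have hol g z : deck p g -> exists r : R * R -> R * R,
    [/\ forall t, (r t).1 ^+ 2 + (r t).2 ^+ 2 = t.1 ^+ 2 + t.2 ^+ 2,
    forall t, exists t', r t' = t &
    forall t, CP2_act (rho g) (normal_exp F z t) = normal_exp F (g z) (r t)].
  exact: (holonomy_normal_exp p F rho SUF Hrho g z).
exists (normal_tube F D); split.
- split.
  + exact: open_normal_tube.
  + exact: normal_tube_CH2.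
  + move=> x /(CH2_normal_exp F dF)[z [t [tD <-]]].
    have : (p @` closure D) (p z) by rewrite pD.
    move=> [w Dw /(deck_transitive p disc_hausdorff cov contr)[g dg gw]].
    (* The normal coordinate at [w] is [t] rotated back, so that the action of [g] restores [t]. *)
    have [r [r2 rsurj rhoE]] := hol g w dg; have [t' rt'] := rsurj t.
    have t'D : normal_disc t' by rewrite /normal_disc /= -r2 rt'.
    exists g => //; exists (normal_exp F w t'); last by rewrite rhoE gw rt'.
    split; first exact: normal_exp_closure_tube.
    exact: normal_exp_CH2.
  + move=> g g' dg dg' gg'; apply/seteqP; split => // x.
    move=> [[_ /interior_subset[z [t [Dz tD <-]]] <-]].
    move=> [_ /interior_subset[z' [t' [Dz' tD' <-]]]].
    have [r [r2 _ ->]] := hol g z dg; have [r' [r2' _ ->]] := hol g' z' dg'.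
    have rtD : normal_cdisc (r t) by rewrite /normal_cdisc /= r2 ltW.
    have rtD' : normal_cdisc (r' t') by rewrite /normal_cdisc /= r2' ltW.
    (* Injectivity gives [g' z' = g z]. Since [p] is injective on [D], it follows that [z = z'], and
       a deck transformation is determined by one value. *)
    move=> /(iF _ _ _ _ rtD' rtD)[gz _].
    have [_ [_ _ _ _ pg]] := dg; have [_ [_ _ _ _ pg']] := dg'.
    have zz' : z = z' by apply: injD; rewrite ?inE// -pg -gz pg'.
    apply: gg'; apply: (deck_unique p disc_hausdorff cov contr g g' z dg dg').
    by rewrite -gz zz'.
- apply: sub_finite_set (deck_properly_discontinuous p disc_hausdorff cov contr
    (@surface_hausdorff _ X) disc_locally_connected (closure D) cD).
  move=> g [dg [_ [[y /(closure_normal_tube F SUF smF D cD)[z [t [Dz tD <-]]] <-]]]].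
  move=> /(closure_normal_tube F SUF smF D cD)[w [s [Dw sD]]].
  have [r [r2 _ ->]] := hol g z dg.
  have rtD : normal_cdisc (r t) by rewrite /normal_cdisc /= r2.
  (* Injectivity up to the boundary circle yields [w = g z] with both [w] and [z] in [closure D]. *)
  move=> /(iF _ _ _ _ sD rtD)[wgz _].
  by split => //; exists z; rewrite // -wgz.
Qed.
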